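(* Fix $\beta>0$ and $h\in\mathbb{R}$, and suppose there is a number $q<1$ and a constant $C_0$ depending only on $\beta,h$ such that for every $N$, $$\mathbb{E}\langle (R_{12}-q)^4\rangle \le \frac{C_0}{N^2}.$$ Let $g_1,\dots,g_N$ be i.i.d. standard Gaussian random variables independent of the disorder $(g_{ij})$, and define the cavity field $\ell := \frac{1}{\sqrt N}\sum_{i=1}^N g_i\sigma_i$, so that $\langle\ell\rangle = \frac{1}{\sqrt N}\sum_{i=1}^N g_i\langle\sigma_i\rangle$. Then there is a constant $C(\beta,h)$ depending only on $\beta,h$ (and the constants in the hypothesis) such that for every $N$ and every bounded measurable $u:\mathbb{R}\to\mathbb{R}$, $$\mathbb{E}\Bigl(\langle u(\ell)\rangle - \int_{\mathbb{R}} u(t)\,\phi_{\langle\ell\rangle,1-q}(t)\,dt\Bigr)^2 \le \frac{C(\beta,h)\|u\|_\infty^2}{\sqrt N},$$ where $\mathbb{E}$ is the expectation over both $(g_{ij})$ and $(g_i)$.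
   Context: Sherrington–Kirkpatrick model: for a positive integer $N$, let $\Sigma_N=\{-1,1\}^N$ and let $(g_{ij})_{1\le i<j\le N}$ be i.i.d. standard Gaussian random variables (the disorder). Given the disorder, the Gibbs measure on $\Sigma_N$ is $G_N(\sigma)=Z_N^{-1}\exp\bigl(\frac{\beta}{\sqrt N}\sum_{1\le i<j\le N} g_{ij}\sigma_i\sigma_j + h\sum_{i=1}^N\sigma_i\bigr)$, with $Z_N$ the normalizing constant. Replicas $\sigma^1,\sigma^2,\dots$ are independent samples from $G_N$ given the disorder, and $\langle\cdot\rangle$ denotes the corresponding quenched average (expectation over replicas with all Gaussian variables fixed). The overlap is $R_{12}=\frac1N\sum_{i=1}^N\sigma^1_i\sigma^2_i$. $\phi_{\mu,s^2}(x)=\frac{1}{\sqrt{2\pi}s}e^{-(x-\mu)^2/(2s^2)}$ is the Gaussian density with mean $\mu$ and variance $s^2$. *)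

(* Defs.v *)
From HB Require Import structures.
From mathcomp Require Import all_boot all_order all_algebra.
From mathcomp Require Import all_classical all_reals all_analysis.
Set Implicit Arguments. Unset Strict Implicit. Unset Printing Implicit Defensive.
Import Order.TTheory GRing.Theory Num.Theory.
Import numFieldNormedType.Exports.
Local Open Scope classical_set_scope.
Local Open Scope ring_scope.

Section SK.
Variable R : realType.

Definition gauss_density (mu v x : R) : R :=
  (Num.sqrt (2 * pi * v))^-1 * expR (- (x - mu) ^+ 2 / (2 * v)).

Definition scons (t : R) (x : nat -> R) : nat -> R :=
  fun k => if k is k'.+1 then x k' else t.

(* gexp n F = E[F(X)] where X_0, ..., X_{n-1} are i.i.d. standard Gaussians
   (coordinates >= n are set to 0), computed as an iterated Lebesgue
   integral against the standard Gaussian density. *)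
Fixpoint gexp (n : nat) (F : (nat -> R) -> R) : R :=
  match n with
  | 0 => F (fun _ => 0)
  | n'.+1 => \int[@lebesgue_measure R]_(t in setT)
               (gauss_density 0 1 t * gexp n' (fun x => F (scons t x)))
  end.

Definition spin N (s : {ffun 'I_N -> bool}) (i : 'I_N) : R :=
  if s i then 1 else -1.

(* the disorder g_ij is read from the coordinate i*N + j of x (only i<j used);
   the cavity Gaussians g_i from coordinate N*N + i. *)
Definition disorder N (x : nat -> R) (i j : 'I_N) : R := x (i * N + j)%N.
Definition cavity N (x : nat -> R) (i : 'I_N) : R := x (N * N + i)%N.

Definition hamiltonian N (beta h : R) (x : nat -> R) (s : {ffun 'I_N -> bool}) : R :=
  beta / Num.sqrt (N%:R) *
    \sum_(i < N) \sum_(j < N | (i < j)%N) disorder x i j * spin s i * spin s j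
  + h * \sum_(i < N) spin s i.

Definition gibbs_weight N beta h x (s : {ffun 'I_N -> bool}) : R :=
  expR (hamiltonian beta h x s).

Definition partition_fn N beta h x : R :=
  \sum_(s : {ffun 'I_N -> bool}) gibbs_weight beta h x s.

Definition gibbs1 N beta h x (f : {ffun 'I_N -> bool} -> R) : R :=
  (\sum_(s : {ffun 'I_N -> bool}) f s * gibbs_weight beta h x s)
  / partition_fn N beta h x.

Definition gibbs2 N beta h x (f : {ffun 'I_N -> bool} -> {ffun 'I_N -> bool} -> R) : R :=
  (\sum_(s1 : {ffun 'I_N -> bool}) \sum_(s2 : {ffun 'I_N -> bool})
      f s1 s2 * gibbs_weight beta h x s1 * gibbs_weight beta h x s2)
  / (partition_fn N beta h x ^+ 2).

Definition overlap N (s1 s2 : {ffun 'I_N -> bool}) : R :=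
  (N%:R)^-1 * \sum_(i < N) spin s1 i * spin s2 i.

Definition cavity_field N (x : nat -> R) (s : {ffun 'I_N -> bool}) : R :=
  (Num.sqrt (N%:R))^-1 * \sum_(i < N) cavity x i * spin s i.

(* number of Gaussian coordinates used: disorder block N*N + cavity block N *)
Definition ndim (N : nat) : nat := (N * N + N)%N.

End SK.

Arguments gibbs1 {R} N beta h x f.
Arguments gibbs2 {R} N beta h x f.
Arguments partition_fn {R} N beta h x.
Arguments cavity_field {R} N x s.
Arguments overlap {R} N s1 s2.
Arguments gauss_density {R} mu v x.
Arguments gexp {R} n F.

(* Main.v *)
(* For fixed disorder the cavity fields l(s) form a centered Gaussian vector with
   covariance R(s, s').  Writing the Gaussian integral as an average over an
   independent Gaussian variable and expanding the square, the error becomes a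
   Gibbs average of a signed sum of four terms E u(X) u(Y), where (X, Y) is a
   centered Gaussian pair.  By rotation invariance each term depends only on the
   covariance matrix of (X, Y), which is close to (1, q; q, 1) on average, and the
   total variation distance between the two laws is at most a constant times the
   distance between the covariance matrices (chi-square bounds for a scaling and
   for a shear).  The main terms cancel, which leaves E<|R_12 - q|> = O(N^(-1/2)).
   The limiting covariance is nondegenerate because the hypothesis forces
   q >= 0. *)
Require Import Defs.
From HB Require Import structures.
From mathcomp Require Import all_boot all_order all_algebra.
From mathcomp Require Import all_classical all_reals all_analysis.
From mathcomp Require Import measurable_realfun ring lra.
Set Implicit Arguments. Unset Strict Implicit. Unset Printing Implicit Defensive.
Import Order.TTheory GRing.Theory Num.Theory.
Import numFieldNormedType.Exports.
Local Open Scope classical_set_scope.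
Local Open Scope ring_scope.

(** * Affine changes of variables and Gaussian densities *)

(** No derivative of [u] is available, so Gaussian laws must be compared through their densities. A
    chi-square divergence is quadratic in the perturbation; an AM-GM weight of the size of the
    perturbation makes the resulting bound linear. Linearity in the covariance error fixes the rate:
    only the first absolute moment of [R_12 - q] enters, and [|t| <= 1/r + r^3 t^4] with
    [r = sqrt N] reduces it to the fourth moment. The expectation is an iterated one-dimensional
    integral, so rotation invariance is proved for two coordinates and applied inductively: each new
    coordinate is absorbed into a triangular factor of the Gram matrix. A triangular factor is moved
    to the limiting one by two scalings and one shear, which is why these are the only comparisons
    of laws needed. The cost of the comparison is [1 / (1 - q^2)], so it needs [|q| < 1]; the
    hypothesis gives only [q < 1], hence the separate argument for the sign of [q]. *)

Section lebesgue_affine.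
Context {R : realType}.
Notation mu := (@lebesgue_measure R).

Let aff (k e : R) : measurableTypeR R -> measurableTypeR R := fun x => k * x + e.

Let measurable_aff (k e : R) : measurable_fun setT (aff k e).
Proof.
by apply: (@measurable_realfun.measurable_funD _ _ R).
Qed.

(** By uniqueness of Lebesgue measure it suffices to match the pushforward, scaled by [|k|], on
    half-open intervals. A negative [k] swaps the endpoints and the open side of the preimage, hence
    two cases. *)
Lemma lebesgue_measure_affine (k e : R) (A : set R) : k != 0 -> measurable A ->
  (mu A = `|k|%:E * mu ((fun x => k * x + e)%R @^-1` A))%E.
Proof.
move=> k0 mA.
have k0' : 0 <= `|k| by [].
pose m mf : {measure set (measurableTypeR R) -> \bar R} :=
  mscale (NngNum k0') (measure_function_pushforward__canonical__measure_function_Measure mu mf).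
apply: (@lebesgue_measure_unique R (m _ (measurable_aff k e))) => // _ [[a b]] _ <-.
have -> : m _ (measurable_aff k e) `]a, b]%classic =
  (`|k|%:E * mu ((fun x => k * x + e)%R @^-1` `]a, b]%classic))%E by [].
have /orP[kn|kp] := lt_total k0.
- have -> : (fun x : R => k * x + e) @^-1` `]a, b] =
      [set` `[((b - e) / k), ((a - e) / k)[ ].
    apply/seteqP; split => x /=; rewrite !in_itv/=;
      rewrite ler_ndivrMr// ltr_ndivlMr// [x * k]mulrC ltrBlDr lerBrDr => /andP[-> ->] //.
  rewrite !lebesgue_measure_itv/= !lte_fin ltr_ndivrMr// divfK ?ltr0_neq0//.
  rewrite ltrD2r; case: ifP => _; last by rewrite mule0.
  rewrite -!EFinB -EFinM ltr0_norm//; congr EFin.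
  by field.
- have -> : (fun x : R => k * x + e) @^-1` `]a, b] =
      [set` `]((a - e) / k), ((b - e) / k)] ].
    apply/seteqP; split => x /=; rewrite !in_itv/=;
      rewrite ler_pdivlMr// ltr_pdivrMr// [x * k]mulrC ltrBlDr lerBrDr => /andP[-> ->] //.
  rewrite !lebesgue_measure_itv/= !lte_fin ltr_pM2r ?invr_gt0//.
  rewrite ltrD2r; case: ifP => _; last by rewrite mule0.
  rewrite -!EFinB -EFinM gtr0_norm//; congr EFin.
  by field.
Qed.

Lemma ge0_integral_affine (k e : R) (f : R -> \bar R) : k != 0 ->
  measurable_fun setT f -> (forall x, 0 <= f x)%E ->
  (\int[mu]_x f x = `|k|%:E * \int[mu]_x f (k * x + e)%R)%E.
Proof.
move=> k0 mf f0.
have k0' : 0 <= `|k| by [].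
pose nu := measure_function_pushforward__canonical__measure_function_Measure mu
  (measurable_aff k e).
rewrite (@eq_measure_integral _ _ _ _ (mscale (NngNum k0') nu)); last first.
  by move=> A mA _; rewrite [LHS](lebesgue_measure_affine e k0).
rewrite ge0_integral_mscale// /nu /= ge0_integral_pushforward//.
Qed.

End lebesgue_affine.

Section gauss_density.
Context {R : realType}.
Notation mu := (@lebesgue_measure R).
Implicit Types m v s x B : R.

Lemma gauss_density_normal_pdf m v x : 0 < v ->
  gauss_density m v x = normal_pdf m (Num.sqrt v) x.
Proof.
move=> v0; rewrite normal_pdfE ?gt_eqF ?sqrtr_gt0//.
rewrite /gauss_density /normal_peak /normal_fun sqr_sqrtr ?ltW//.
by congr (_ ^-1 * expR (_ / _)); [congr Num.sqrt|]; ring.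
Qed.

Lemma gauss_density_ge0 m v x : 0 <= gauss_density m v x.
Proof. by rewrite mulr_ge0 ?invr_ge0 ?sqrtr_ge0 ?expR_ge0. Qed.

Lemma measurable_gauss_density m v : measurable_fun setT (gauss_density m v).
Proof.
apply: measurable_funM => //; apply: measurableT_comp => //.
apply: measurable_funM => //; apply: measurableT_comp => //.
by apply: measurable_funX; apply: measurable_funB.
Qed.

Lemma integral_gauss_density m v : 0 < v ->
  (\int[mu]_x (gauss_density m v x)%:E = 1)%E.
Proof.
move=> v0; rewrite -[RHS](integral_normal_pdf m (Num.sqrt v)).
by apply: eq_integral => x _; rewrite gauss_density_normal_pdf.
Qed.

Lemma integrable_gauss_density m v : 0 < v ->
  mu.-integrable setT (fun x => (gauss_density m v x)%:E).
Proof.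
move=> v0; have := integrable_normal_pdf m (Num.sqrt v).
by congr (integrable _ _ _); apply/funext => x; rewrite gauss_density_normal_pdf.
Qed.

Lemma integrable_gauss_bounded m v (f : R -> R) B : 0 < v ->
  measurable_fun setT f -> (forall x, `|f x| <= B) ->
  mu.-integrable setT (EFin \o (fun x => gauss_density m v x * f x)).
Proof.
move=> v0 mf fB.
have -> : EFin \o (fun x => gauss_density m v x * f x) =
   ((fun x => (gauss_density m v x)%:E) \* (EFin \o f))%E.
  by apply/funext => x /=; rewrite EFinM.
apply: integrableMl => //; first exact: integrable_gauss_density.
exists B; split; first exact: num_real.
by move=> M BM x _; apply: le_trans (fB x) (ltW BM).
Qed.

End gauss_density.

(** * One-variable Gaussian expectation of bounded measurable functions *)

Section bounded_measurable.
Context {R : realType}.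

Definition bmeas d (T : measurableType d) (f : T -> R) :=
  measurable_fun setT f /\ exists B : R, forall x, `|f x| <= B.

Lemma bmeas_cst d (T : measurableType d) (c : R) : bmeas (fun _ : T => c).
Proof. by split=> //; exists `|c|. Qed.

Lemma bmeas_comp d d' (T : measurableType d) (T' : measurableType d')
    (f : T -> R) (g : T' -> T) :
  bmeas f -> measurable_fun setT g -> bmeas (fun x => f (g x)).
Proof.
move=> [mf [B fB]] mg; split; first exact: (measurableT_comp mf mg).
by exists B.
Qed.

Lemma bmeasD d (T : measurableType d) (f g : T -> R) :
  bmeas f -> bmeas g -> bmeas (fun x => f x + g x).
Proof.
move=> [mf [B fB]] [mg [C gC]]; split; first exact: measurable_funD.
exists (B + C) => x; exact: le_trans (ler_normD _ _) (lerD (fB x) (gC x)).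
Qed.

Lemma bmeasM d (T : measurableType d) (f g : T -> R) :
  bmeas f -> bmeas g -> bmeas (fun x => f x * g x).
Proof.
move=> [mf [B fB]] [mg [C gC]]; split; first exact: measurable_funM.
by exists (B * C) => x; rewrite normrM ler_pM.
Qed.

Lemma bmeasB d (T : measurableType d) (f g : T -> R) :
  bmeas f -> bmeas g -> bmeas (fun x => f x - g x).
Proof.
move=> [mf [B fB]] [mg [C gC]]; split; first exact: measurable_funB.
exists (B + C) => x; exact: le_trans (ler_normB _ _) (lerD (fB x) (gC x)).
Qed.

Lemma bmeas_pair1 d d' (T : measurableType d) (T' : measurableType d')
    (f : T * T' -> R) (x : T) : bmeas f -> bmeas (fun y => f (x, y)).
Proof. by move=> bf; apply: (bmeas_comp bf). Qed.

End bounded_measurable.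

Section gaussE.
Context {R : realType}.
Notation mu := (@lebesgue_measure R).
Notation gd := (@gauss_density R 0 1).
Implicit Types (f g : R -> R) (B c s : R).

Definition gaussE f : R := \int[mu]_t (gauss_density 0 1 t * f t).

Let integrable_gaussE f : bmeas f ->
  mu.-integrable setT (EFin \o (fun x => gd x * f x)).
Proof. by move=> [mf [B fB]]; exact: (integrable_gauss_bounded _ _ mf fB). Qed.

Lemma gaussE_cst c : gaussE (fun=> c) = c.
Proof.
rewrite /gaussE RintegralZr//; last exact: integrable_gauss_density.
by rewrite /Rintegral integral_gauss_density//= mul1r.
Qed.

Lemma gaussED f g : bmeas f -> bmeas g ->
  gaussE (fun x => f x + g x) = gaussE f + gaussE g.
Proof.
move=> bf bg; rewrite -RintegralD//; try exact: integrable_gaussE.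
by congr Rintegral; apply/funext => x; rewrite mulrDr.
Qed.

Lemma gaussEZ c f : bmeas f -> gaussE (fun x => c * f x) = c * gaussE f.
Proof.
move=> bf; rewrite -RintegralZl//; last exact: integrable_gaussE.
by congr Rintegral; apply/funext => x; rewrite mulrCA.
Qed.

Lemma gaussEB f g : bmeas f -> bmeas g ->
  gaussE (fun x => f x - g x) = gaussE f - gaussE g.
Proof.
move=> bf bg; rewrite -RintegralB//; try exact: integrable_gaussE.
by congr Rintegral; apply/funext => x; rewrite mulrBr.
Qed.

Lemma le_gaussE f g : bmeas f -> bmeas g -> (forall x, f x <= g x) ->
  gaussE f <= gaussE g.
Proof.
move=> bf bg fg; apply: le_Rintegral => //; try exact: integrable_gaussE.
by move=> x _; rewrite ler_wpM2l ?gauss_density_ge0.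
Qed.

Lemma normr_gaussE f B : measurable_fun setT f -> (forall x, `|f x| <= B) ->
  `|gaussE f| <= B.
Proof.
move=> mf fB; have bf : bmeas f by split=> //; exists B.
rewrite ler_norml; apply/andP; split.
  rewrite -[leLHS](gaussE_cst (- B)); apply: le_gaussE => //; first exact: bmeas_cst.
  by move=> x; have := fB x; rewrite ler_norml => /andP[].
rewrite -[leRHS](gaussE_cst B); apply: le_gaussE => //; first exact: bmeas_cst.
by move=> x; have := fB x; rewrite ler_norml => /andP[].
Qed.

Lemma EFin_gaussE f : bmeas f ->
  ((gaussE f)%:E = \int[mu]_x (gd x * f x)%:E)%E.
Proof. by move=> bf; rewrite /gaussE fineK//; apply: integrable_fin_num => //; exact: integrable_gaussE. Qed.

Lemma bmeas_gaussE d (T : measurableType d) (f : T * R -> R) : bmeas f ->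
  bmeas (fun t => gaussE (fun x => f (t, x))).
Proof.
move=> bf; have [mf [B fB]] := bf; split; last first.
  exists B => t; apply: normr_gaussE => //.
  by have [] := bmeas_pair1 t bf.
(* Tonelli needs a nonnegative integrand: [f + B] is one, and the constant is subtracted after
   integration. *)
have -> : (fun t => gaussE (fun x => f (t, x))) =
    (fun t => gaussE (fun x => f (t, x) + B) - B).
  apply/funext => t; rewrite gaussED ?gaussE_cst ?addrK//; [exact: bmeas_pair1|exact: bmeas_cst].
apply: measurable_funB => //.
apply: measurableT_comp => //.
apply: (@measurable_fun_fubini_tonelli_F _ _ _ _ _ mu
  (fun z : T * R => (gd z.2 * (f z + B))%:E)) => /=.
  apply/measurable_EFinP; apply: measurable_funM.
    by apply: measurableT_comp => //; exact: measurable_gauss_density.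
  exact: measurable_funD.
move=> z; rewrite lee_fin mulr_ge0 ?gauss_density_ge0//.
by have := fB z; rewrite ler_norml => /andP[+ _]; rewrite -subr_ge0 opprK addrC.
Qed.

Lemma gaussE_affine (f : R -> R) (m s : R) : bmeas f -> 0 < s ->
  gaussE (fun z => f (m + s * z)) = \int[mu]_y (gauss_density m (s ^+ 2) y * f y).
Proof.
move=> bf s0; have [mf [B fB]] := bf.
have s20 : 0 < s ^+ 2 by rewrite exprn_gt0.
have maff : measurable_fun setT (fun z : R => m + s * z).
  by apply: measurable_funD => //; exact: measurable_funM.
(* The substitution is made for nonnegative functions in the extended reals, then applied to
   [f + B]; the extra [B] cancels because both densities have mass 1. *)
have pos g : measurable_fun setT g -> (forall x, 0 <= g x) ->
    (\int[mu]_z (gd z * g (m + s * z))%:E =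
     \int[mu]_y (gauss_density m (s ^+ 2) y * g y)%:E)%E.
  move=> mg g0; rewrite [RHS](@ge0_integral_affine _ s m) ?gt_eqF//; first last.
  - by move=> x; rewrite lee_fin mulr_ge0 ?gauss_density_ge0.
  - by apply/measurable_EFinP; apply: measurable_funM => //; exact: measurable_gauss_density.
  rewrite gtr0_norm// -ge0_integralZl//=; first last.
  - by rewrite lee_fin ltW.
  - by move=> x _; rewrite lee_fin mulr_ge0 ?gauss_density_ge0.
  - apply/measurable_EFinP; apply: measurable_funM.
      apply: measurableT_comp; first exact: measurable_gauss_density.
      by apply: measurable_funD => //; exact: measurable_funM.
    apply: measurableT_comp => //.
    by apply: measurable_funD => //; exact: measurable_funM.
  apply: eq_integral => z _; rewrite -EFinM mulrA [m + _]addrC; congr (_ * _)%:E.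
  have s2pi : Num.sqrt (2 * pi * s ^+ 2) = Num.sqrt (2 * pi) * s.
    by rewrite sqrtrM ?mulr_ge0 ?pi_ge0// sqrtr_sqr gtr0_norm.
  rewrite /gauss_density addrK subr0 mulr1 s2pi.
  have sn0 : s != 0 by rewrite gt_eqF.
  have -> : - (s * z) ^+ 2 / (2 * s ^+ 2) = - z ^+ 2 / (2 * 1) by field.
  by rewrite [RHS]mulrA; congr (_ * _); rewrite invfM mulrCA mulfV// mulr1.
have bfB : bmeas (fun x => f x + B) by apply: bmeasD => //; exact: bmeas_cst.
have bfs : bmeas (fun z => f (m + s * z)) by exact: bmeas_comp.
have e1 : gaussE (fun z => f (m + s * z)) = gaussE (fun z => f (m + s * z) + B) - B.
  by rewrite gaussED ?gaussE_cst ?addrK//; exact: bmeas_cst.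
rewrite e1 /gaussE /Rintegral (pos (fun x => f x + B)); last 2 first.
- exact: measurable_funD.
- by move=> z; have := fB z; rewrite ler_norml => /andP[+ _]; rewrite -subr_ge0 opprK addrC.
apply/eqP; rewrite subr_eq; apply/eqP.
have igd := integrable_gauss_density m s20.
rewrite -[X in _ = _ + X]mul1r -[X in _ + X * _](_ : \int[mu]_x gauss_density m (s ^+ 2) x = 1); last first.
  by rewrite /Rintegral integral_gauss_density.
rewrite -RintegralZr// -RintegralD//; last 2 first.
- exact: integrable_gauss_bounded mf fB.
- apply: (@integrable_gauss_bounded _ _ _ (fun=> B) `|B|) => //.
by congr fine; apply: eq_integral => y _; rewrite mulrDr.
Qed.

End gaussE.

(** * Rotation invariance *)

Section rotation.
Context {R : realType}.
Notation mu := (@lebesgue_measure R).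
Notation gd := (@gauss_density R 0 1).

(** For [c != 0] a rotation splits into two one-variable affine substitutions. At fixed [y] pass
    from [x] to [X = c x + s y]; the other coordinate [- s x + c y] is then [(y - s X) / c], which
    replaces [y] at fixed [X]. [H] is the integrand in the mixed variables [(X, y)], and the factors
    [|c|] and [1 / |c|] cancel. *)
Let ge0_integral_rotation (c s : R) (G : R * R -> \bar R) : c != 0 ->
  c ^+ 2 + s ^+ 2 = 1 -> measurable_fun setT G -> (forall z, 0 <= G z)%E ->
  (\int[mu]_x \int[mu]_y G (c * x + s * y, - s * x + c * y)%R =
   \int[mu]_x \int[mu]_y G (x, y))%E.
Proof.
move=> c0 cs mG G0.
pose H := fun z : R * R => G (z.1, (z.2 - s * z.1) / c).
have mH : measurable_fun setT H.
  apply: measurableT_comp => //; apply: measurable_fun_pair => //=.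
  by apply: measurable_funM => //; apply: measurable_funB => //; apply: measurable_funM.
have mrot : measurable_fun setT
    (fun z : R * R => G (c * z.1 + s * z.2, - s * z.1 + c * z.2)).
  apply: measurableT_comp => //; apply: measurable_fun_pair => //=;
    by apply: measurable_funD => //; apply: measurable_funM.
have H0 z : (0 <= H z)%E by exact: G0.
have mH1 y : measurable_fun setT (fun w => H (w, y)).
  by apply: measurableT_comp => //; exact: measurable_fun_pair.
have mG2 x : measurable_fun setT (fun y => G (x, y)).
  by apply: measurableT_comp => //; exact: measurable_fun_pair.
have mH2 x : measurable_fun setT (fun w => H (x, w)).
  by apply: measurableT_comp => //; exact: measurable_fun_pair.
have ci0 : (0 <= `|c^-1|%:E)%E by rewrite lee_fin.
transitivity (\int[mu]_x (`|c^-1|%:E * \int[mu]_y H (x, y)))%E; last first.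
  apply: eq_integral => x _.
  rewrite [RHS](@ge0_integral_affine _ c^-1 (- (s * x) / c)) ?invr_eq0//.
  congr (_ * _)%E; apply: eq_integral => y _.
  by rewrite /H/=; congr (G (_, _)); field.
rewrite ge0_integralZl//; last 2 first.
- apply: (@measurable_fun_fubini_tonelli_F _ _ _ _ _ mu H); [exact: mH|by move=> z; exact: G0].
- by move=> x _; apply: integral_ge0 => y _; exact: H0.
rewrite (fubini_tonelli (m1 := mu) (m2 := mu) H mH H0).
rewrite -ge0_integralZl//; last 2 first.
- apply: (@measurable_fun_fubini_tonelli_G _ _ _ _ _ mu H); [exact: mH|by move=> z; exact: G0].
- by move=> y _; apply: integral_ge0 => x _; exact: H0.
rewrite (fubini_tonelli (m1 := mu) (m2 := mu) (fun z : R * R => G (c * z.1 + s * z.2, - s * z.1 + c * z.2)) mrot (fun z => G0 _)).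
apply: eq_integral => y _ /=.
rewrite [X in (_ * X)%E](@ge0_integral_affine _ c (s * y))//.
rewrite muleA -EFinM -normrM mulVf// normr1 mul1e.
apply: eq_integral => x _; rewrite /H/=; congr (G (_, _)).
have -> : s * (c * x + s * y) = s * c * x + (1 - c ^+ 2) * y by rewrite -cs; ring.
by field.
Qed.

Let gaussE2_ge0 (f : R * R -> R) : bmeas f -> (forall z, 0 <= f z) ->
  ((gaussE (fun x => gaussE (fun y => f (x, y))))%:E =
   \int[mu]_x \int[mu]_y (gd x * gd y * f (x, y))%:E)%E.
Proof.
move=> bf f0; rewrite EFin_gaussE; last exact: bmeas_gaussE.
apply: eq_integral => x _; rewrite EFinM EFin_gaussE; last exact: bmeas_pair1.
have [mf _] := bmeas_pair1 x bf.
rewrite -ge0_integralZl//; last 3 first.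
- by apply/measurable_EFinP; apply: measurable_funM => //; exact: measurable_gauss_density.
- by move=> y _; rewrite lee_fin mulr_ge0 ?gauss_density_ge0.
- by rewrite lee_fin gauss_density_ge0.
by apply: eq_integral => y _; rewrite -EFinM mulrA.
Qed.

(** The density of two independent standard Gaussians depends only on [x^2 + y^2], so the rotation
    of Lebesgue integrals carries over. *)
Let gaussE_rotation_ne0 (c s : R) (f : R * R -> R) : c != 0 ->
  c ^+ 2 + s ^+ 2 = 1 -> bmeas f ->
  gaussE (fun x => gaussE (fun y => f (c * x + s * y, - s * x + c * y))) =
  gaussE (fun x => gaussE (fun y => f (x, y))).
Proof.
move=> c0 cs; wlog f0 : f / forall z, 0 <= f z.
  move=> H bf; have [mf [B fB]] := bf.
  have bfB : bmeas (fun z => f z + B) by apply: bmeasD => //; exact: bmeas_cst.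
  have brot (g : R * R -> R) : bmeas g ->
      bmeas (fun z : R * R => g (c * z.1 + s * z.2, - s * z.1 + c * z.2)).
    move=> bg; apply: (bmeas_comp bg); apply: measurable_fun_pair => //=;
      by apply: measurable_funD => //; apply: measurable_funM.
  have := H (fun z => f z + B) _ bfB.
  have shiftB (g : R * R -> R) : bmeas g ->
      gaussE (fun x => gaussE (fun y => g (x, y) + B)) =
      gaussE (fun x => gaussE (fun y => g (x, y))) + B.
    move=> bg; rewrite -[in RHS](gaussE_cst B) -gaussED; last 2 first.
    - exact: bmeas_gaussE.
    - exact: bmeas_cst.
    congr gaussE; apply/funext => x; rewrite gaussED ?gaussE_cst//.
    - exact: bmeas_pair1.
    - exact: bmeas_cst.
  rewrite (shiftB _ bf) (shiftB _ (brot _ bf)) => /(_ _)/addIr; apply => z.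
  by have := fB z; rewrite ler_norml => /andP[+ _]; rewrite -subr_ge0 opprK addrC.
move=> bf; apply: EFin_inj.
have brot : bmeas (fun z : R * R => f (c * z.1 + s * z.2, - s * z.1 + c * z.2)).
  apply: (bmeas_comp bf); apply: measurable_fun_pair => //=;
    by apply: measurable_funD => //; apply: measurable_funM.
rewrite [RHS](gaussE2_ge0 bf f0).
apply: etrans (gaussE2_ge0 brot _) _; first by move=> z; exact: f0.
apply: etrans _ (@ge0_integral_rotation c s (fun z => (gd z.1 * gd z.2 * f z)%:E) c0 cs _ _).
- apply: eq_integral => x _; apply: eq_integral => y _; congr (_ * _)%:E.
  rewrite /= /gauss_density ![_ * expR _ * _]mulrACA -!expRD; congr (_ * expR _).
  rewrite !subr0 -!mulrDl; congr (_ / _).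
  transitivity (- ((c ^+ 2 + s ^+ 2) * (x ^+ 2 + y ^+ 2)) : R); last by ring.
  by rewrite cs; ring.
- apply/measurable_EFinP; apply: measurable_funM; last by case: bf.
  by apply: measurable_funM; apply: measurableT_comp => //; exact: measurable_gauss_density.
- by move=> z; rewrite lee_fin !mulr_ge0 ?gauss_density_ge0.
Qed.

Lemma gaussE_rotation (c s : R) (f : R * R -> R) :
  c ^+ 2 + s ^+ 2 = 1 -> bmeas f ->
  gaussE (fun x => gaussE (fun y => f (c * x + s * y, - s * x + c * y))) =
  gaussE (fun x => gaussE (fun y => f (x, y))).
Proof.
have [->|c0] := eqVneq c 0; last exact: gaussE_rotation_ne0.
rewrite expr0n/= add0r => s21 bf.
(* A quarter turn is the composite of two eighth turns. *)
pose r : R := Num.sqrt 2^-1.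
have r2 : r ^+ 2 = 2^-1 by rewrite sqr_sqrtr.
have r0 : r != 0 by rewrite gt_eqF// sqrtr_gt0.
have cs : r ^+ 2 + (s * r) ^+ 2 = 1 by rewrite exprMn s21 r2; field.
pose g (z : R * R) := f (r * z.1 + s * r * z.2, - (s * r) * z.1 + r * z.2).
have bg : bmeas g.
  apply: (bmeas_comp bf); apply: measurable_fun_pair => //=;
    by apply: measurable_funD => //; apply: measurable_funM.
rewrite -(gaussE_rotation_ne0 r0 cs bf) -(gaussE_rotation_ne0 r0 cs bg).
congr gaussE; apply/funext => x; congr gaussE; apply/funext => y.
have ss : s * s = 1 by rewrite -expr2.
have rr : r * r = 2^-1 by rewrite -expr2.
rewrite /g/=; congr (f (_, _)).
- transitivity ((1 - s * s) * (r * r) * x + 2 * s * (r * r) * y); last by ring.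
  by rewrite ss rr; field.
- transitivity (- 2 * s * (r * r) * x + (1 - s * s) * (r * r) * y); last by ring.
  by rewrite ss rr; field.
Qed.

(** Completing [(a, b) / r] to a rotation makes the integrand depend on the first coordinate alone.
    The direction is undefined when [r = 0], but then [a = b = 0]. *)
Lemma gaussE_sum (a b : R) (f : R -> R) : bmeas f ->
  gaussE (fun x => gaussE (fun y => f (a * x + b * y))) =
  gaussE (fun x => f (Num.sqrt (a ^+ 2 + b ^+ 2) * x)).
Proof.
move=> bf; set r := Num.sqrt _.
have r2 : r ^+ 2 = a ^+ 2 + b ^+ 2 by rewrite sqr_sqrtr// addr_ge0// sqr_ge0.
have [r0|r0] := eqVneq r 0.
  move/eqP: r2; rewrite r0 expr0n/= eq_sym paddr_eq0 ?sqr_ge0// !sqrf_eq0.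
  move=> /andP[/eqP -> /eqP ->]; congr gaussE; apply/funext => x.
  rewrite -[RHS]gaussE_cst; congr gaussE; apply/funext => y.
  by rewrite !mul0r addr0.
have cs : (a / r) ^+ 2 + (b / r) ^+ 2 = 1.
  by rewrite !expr_div_n -mulrDl -r2 divff// expf_neq0.
have bg : bmeas (fun z : R * R => f (r * z.1)).
  by apply: (bmeas_comp bf); exact: measurable_funM.
transitivity (gaussE (fun x => gaussE (fun y => f (r * (a / r * x + b / r * y))))).
  congr gaussE; apply/funext => x; congr gaussE; apply/funext => y.
  by congr f; field.
rewrite (gaussE_rotation cs bg); congr gaussE; apply/funext => x /=.
by rewrite gaussE_cst.
Qed.

End rotation.

(** * Total variation bounds *)

Section gauss_comparison.
Context {R : realType}.
Notation mu := (@lebesgue_measure R).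
Implicit Types (f : R -> R) (m s B : R).

Lemma gauss_density_gt0 m (v x : R) : 0 < v -> 0 < gauss_density m v x.
Proof.
by move=> v0; rewrite mulr_gt0 ?expR_gt0// invr_gt0 sqrtr_gt0 !mulr_gt0// pi_gt0.
Qed.

(* The hypothesis says that p^2 / p' has total mass k, i.e. that the chi-square
   divergence of p from p' is k - 1; AM-GM is used with weight eta. *)
Lemma gauss_chi2 (m a m' b m'' w k eta B : R) f :
  0 < a -> 0 < b -> 0 < w -> 0 < eta ->
  (forall y, gauss_density m a y ^+ 2 =
     k * gauss_density m'' w y * gauss_density m' b y) ->
  measurable_fun setT f -> (forall x, `|f x| <= B) ->
  `|\int[mu]_y (gauss_density m a y * f y) - \int[mu]_y (gauss_density m' b y * f y)|
  <= B / 2 * (eta + (k - 1) / eta).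
Proof.
move=> a0 b0 w0 eta0 hk mf fB.
have B0 : 0 <= B by apply: le_trans (fB 0).
have ia := integrable_gauss_bounded m a0 mf fB.
have ib := integrable_gauss_bounded m' b0 mf fB.
rewrite -RintegralB//; apply: le_trans (le_normr_Rintegral _ _) _ => //.
  by have := integrableB measurableT ia ib; apply: eq_integrable => // x _ /=; rewrite EFinB.
(* Coefficients of [p'], [r] and [p] in [B / 2 * (eta p' + (p - p')^2 / (eta p'))], where
   [(p - p')^2 / p' = k r - 2 p + p']. Each density has mass 1, so the integral of the majorant is
   [c1 + c2 + c3]. *)
pose c1 := B / 2 * (eta + eta^-1); pose c2 := B / 2 * k / eta; pose c3 := - (B / eta).
have i1 c n v : 0 < v -> mu.-integrable setT (EFin \o (fun y => c * gauss_density n v y)).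
  move=> v0; have := integrableZl measurableT c (integrable_gauss_density n v0).
  by apply: eq_integrable => // x _ /=; rewrite EFinM.
have i12 : mu.-integrable setT (EFin \o (fun y =>
    c1 * gauss_density m' b y + c2 * gauss_density m'' w y)).
  have := integrableD measurableT (i1 c1 m' b b0) (i1 c2 m'' w w0).
  by apply: eq_integrable => // x _ /=; rewrite EFinD.
have i123 : mu.-integrable setT (EFin \o (fun y =>
    c1 * gauss_density m' b y + c2 * gauss_density m'' w y + c3 * gauss_density m a y)).
  have := integrableD measurableT i12 (i1 c3 m a a0).
  by apply: eq_integrable => // x _ /=; rewrite EFinD.
have int1 n v : 0 < v -> \int[mu]_y gauss_density n v y = 1.
  by move=> v0; rewrite /Rintegral integral_gauss_density.
have intc c n v : 0 < v -> \int[mu]_y (c * gauss_density n v y) = c.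
  move=> v0; rewrite RintegralZl ?int1 ?mulr1//; exact: integrable_gauss_density.
apply: (@le_trans _ _ (\int[mu]_y (c1 * gauss_density m' b y + c2 * gauss_density m'' w y
   + c3 * gauss_density m a y))); last first.
  rewrite (RintegralD _ i12 (i1 c3 m a a0))//.
  rewrite (RintegralD _ (i1 c1 m' b b0) (i1 c2 m'' w w0))//.
  rewrite !intc// /c1 /c2 /c3.
  rewrite le_eqVlt; apply/orP; left; apply/eqP; field.
  by rewrite gt_eqF.
apply: le_Rintegral => //.
  have := integrableB measurableT ia ib.
  by move=> /(integrable_norm); apply: eq_integrable.
move=> y _; rewrite -mulrBl normrM.
have p'0 := gauss_density_gt0 m' y b0.
move: (hk y); set p := gauss_density m a y; set p' := gauss_density m' b y in p'0 *.
set r := gauss_density m'' w y => pE.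
apply: (@le_trans _ _ (`|p - p'| * B)); first by rewrite ler_wpM2l.
have -> : c1 * p' + c2 * r + c3 * p = B * ((eta * p' + (k * r - 2 * p + p') / eta) / 2).
  by rewrite /c1 /c2 /c3; field; rewrite gt_eqF.
rewrite mulrC; apply: ler_wpM2l => //.
rewrite -(ler_pM2r (mulr_gt0 eta0 p'0)).
have -> : (eta * p' + (k * r - 2 * p + p') / eta) / 2 * (eta * p') =
    ((eta * p') ^+ 2 + (k * r * p' - 2 * p * p' + p' ^+ 2)) / 2.
  by field; rewrite gt_eqF.
rewrite -pE.
have -> : p ^+ 2 - 2 * p * p' + p' ^+ 2 = `|p - p'| ^+ 2.
  by rewrite real_normK ?num_real//; ring.
have := sqr_ge0 (`|p - p'| - eta * p'); nra.
Qed.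

Let sqr_gauss_density m v y : 0 < v -> gauss_density m v y ^+ 2 =
  (2 * pi * v)^-1 * expR (- (y - m) ^+ 2 / v).
Proof.
move=> v0; rewrite /gauss_density exprMn exprVn sqr_sqrtr; last first.
  by rewrite !mulr_ge0// ?pi_ge0// ltW.
rewrite [X in _ * X]expr2 -expRD; congr (_ * expR _); field.
by rewrite gt_eqF.
Qed.

Let inv_sqrt_le (x e : R) : 0 <= e -> e <= 2^-1 -> x = 1 - e ^+ 2 ->
  (Num.sqrt x)^-1 - 1 <= e ^+ 2.
Proof.
move=> e0 e12 xE.
have e24 : e ^+ 2 <= 4^-1 by nra.
have x0 : 0 < x by lra.
have r0 : 0 < Num.sqrt x by rewrite sqrtr_gt0.
have r2 : Num.sqrt x ^+ 2 = 1 - e ^+ 2 by rewrite sqr_sqrtr ?ltW.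
rewrite lerBlDr -[leLHS]mul1r ler_pdivrMr//.
have e20 := sqr_ge0 e.
rewrite -(@ler_pXn2r _ 2)// ?nnegrE ?expr1n ?exprMn ?r2; last 2 first.
- by [].
- by rewrite mulr_ge0 ?addr_ge0// ltW.
by move: (e ^+ 2) e20 e24 => z z0 z4; nra.
Qed.

(** Here [p^2 / p'] is a multiple of the centred Gaussian density of variance [w = s^2 / (2 - s^2)],
    with mass [k = (1 - e^2)^(-1/2)] for [e = |s^2 - 1|]. Since [k - 1 <= e^2] when [e <= 1/2], the
    weight [eta = e] gives a bound linear in [e]; the weight must be positive, so [e = 0] is treated
    apart. *)
Lemma gaussE_scale f (s B : R) : bmeas f -> (forall x, `|f x| <= B) -> 0 < s ->
  `|s ^+ 2 - 1| <= 2^-1 ->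
  `|gaussE (fun z => f (s * z)) - gaussE f| <= B * `|s ^+ 2 - 1|.
Proof.
move=> bf fB s0; set e := `|s ^+ 2 - 1| => e12.
have [mf _] := bf.
have B0 : 0 <= B by apply: le_trans (fB 0).
have [s1|s1] := eqVneq (s ^+ 2) 1.
  have -> : s = 1.
    by apply/eqP; rewrite -(@eqrXn2 _ 2)// ?expr1n ?ltW//; apply/eqP.
  under eq_fun do rewrite mul1r.
  by rewrite subrr normr0 mulr_ge0// /e normr_ge0.
have e0 : 0 < e by rewrite normr_gt0 subr_eq0.
have s20 : 0 < s ^+ 2 by rewrite exprn_gt0.
have ss : 2^-1 <= s ^+ 2 <= 1 + 2^-1.
  by move: e12; rewrite /e ler_norml => /andP[h1 h2]; apply/andP; split; lra.
have s2' : 0 < 2 - s ^+ 2 by lra.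
have es : s ^+ 2 * (2 - s ^+ 2) = 1 - e ^+ 2.
  by rewrite /e real_normK ?num_real//; ring.
pose w := s ^+ 2 / (2 - s ^+ 2).
have w0 : 0 < w by rewrite divr_gt0.
pose k := (Num.sqrt (s ^+ 2 * (2 - s ^+ 2)))^-1.
have sq0 : 0 < s ^+ 2 * (2 - s ^+ 2) by rewrite mulr_gt0.
have -> : gaussE (fun z => f (s * z)) = \int[mu]_y (gauss_density 0 (s ^+ 2) y * f y).
  by rewrite -gaussE_affine//; congr gaussE; apply/funext => z; rewrite add0r.
apply: le_trans (gauss_chi2 (m'' := 0) (w := w) (k := k) s20 ltr01 w0 e0 _ mf fB) _.
  move=> y; rewrite sqr_gauss_density// /gauss_density !subr0.
  set P1 := Num.sqrt (2 * pi * w); set P2 := Num.sqrt (2 * pi * 1).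
  set E1 := expR (- y ^+ 2 / (2 * w)); set E2 := expR (- y ^+ 2 / (2 * 1)).
  transitivity ((k * P1^-1 * P2^-1) * (E1 * E2)); last by ring.
  rewrite -expRD; congr (_ * expR _); last first.
    by rewrite /w; field; rewrite !gt_eqF.
  have p0 : 0 < pi :> R by exact: pi_gt0.
  rewrite /k /P1 /P2 -!invfM -!sqrtrM ?mulr_ge0 ?invr_ge0 ?ltW//; congr (_^-1).
  have -> : s ^+ 2 * (2 - s ^+ 2) * (2 * pi * w) * (2 * pi * 1) = (2 * pi * s ^+ 2) ^+ 2.
    by rewrite /w; field; rewrite gt_eqF.
  by rewrite sqrtr_sqr ger0_norm// !mulr_ge0 ?ltW.
rewrite -mulrA ler_wpM2l// ler_pdivrMl//.
suff : (k - 1) / e <= e by lra.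
by rewrite ler_pdivrMr// -expr2; apply: inv_sqrt_le (ltW e0) e12 es.
Qed.

(** For unit Gaussians centred at [c] and 0, [p^2 / p'] is [exp (c^2)] times the unit Gaussian
    density centred at [2 c]. The weight stays free so that one value can serve all the shifts
    occurring in a shear. *)
Let gaussE_shift f (c B eta : R) : bmeas f -> (forall x, `|f x| <= B) -> 0 < eta ->
  `|gaussE (fun z => f (z + c)) - gaussE f| <= B / 2 * (eta + (expR (c ^+ 2) - 1) / eta).
Proof.
move=> bf fB eta0; have [mf _] := bf.
have -> : gaussE (fun z => f (z + c)) = \int[mu]_y (gauss_density c 1 y * f y).
  rewrite -[X in gauss_density _ X](expr1n _ 2) -gaussE_affine//.
  by congr gaussE; apply/funext => z; rewrite mul1r addrC.
apply: (gauss_chi2 (m'' := 2 * c) (w := 1)) => // y.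
rewrite sqr_gauss_density// /gauss_density.
set P := Num.sqrt (2 * pi * 1); set E0 := expR (c ^+ 2).
set E1 := expR _; set E2 := expR (- (y - 2 * c) ^+ 2 / (2 * 1)); set E3 := expR _.
transitivity ((P^-1 * P^-1) * (E0 * E2 * E3)); last by ring.
rewrite -!expRD -invfM -expr2 sqr_sqrtr ?mulr_ge0 ?pi_ge0//; congr (_ * expR _).
by field.
Qed.

(** For fixed [x] the shear shifts [y] by [c x]. With the single weight [e = 2 |c|] only
    [exp (c^2 x^2)] remains to be averaged over [x], and its Gaussian mean is
    [k = (1 - 2 c^2)^(-1/2) <= 1 + e^2]. *)
Lemma gaussE_shear (f : R * R -> R) (c B : R) : bmeas f -> (forall z, `|f z| <= B) ->
  `|c| <= 2^-1 ->
  `|gaussE (fun x => gaussE (fun y => f (x, y + c * x))) -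
    gaussE (fun x => gaussE (fun y => f (x, y)))| <= 2 * B * `|c|.
Proof.
move=> bf fB c12; have [mf _] := bf.
have B0 : 0 <= B by apply: le_trans (fB (0, 0)).
have [->|c0] := eqVneq c 0.
  under [X in gaussE X - _]eq_fun do under eq_fun do rewrite mul0r addr0.
  by rewrite subrr normr0 mulr0.
have bsh : bmeas (fun z : R * R => f (z.1, z.2 + c * z.1)).
  apply: (bmeas_comp bf); apply: measurable_fun_pair => //=.
  by apply: measurable_funD => //; apply: measurable_funM.
pose D x := gaussE (fun y => f (x, y + c * x)) - gaussE (fun y => f (x, y)).
have b1 := bmeas_gaussE bsh; have b2 := bmeas_gaussE bf.
have bD : bmeas D by exact: bmeasB b1 b2.
rewrite -gaussEB// -/D.
have [mD [B' DB']] := bD.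
have iD := integrable_gauss_bounded 0 ltr01 mD DB'.
pose e := 2 * `|c|.
have e0 : 0 < e by rewrite mulr_gt0 ?normr_gt0.
pose w := (1 - 2 * c ^+ 2)^-1.
have c2 : c ^+ 2 <= 4^-1 by rewrite -[c ^+ 2]real_normK ?num_real//; have := normr_ge0 c; nra.
have w0' : 0 < 1 - 2 * c ^+ 2 by lra.
have w0 : 0 < w by rewrite invr_gt0.
pose k := Num.sqrt w.
have gdk x : gauss_density 0 1 x * expR ((c * x) ^+ 2) = k * gauss_density 0 w x.
  rewrite /gauss_density !subr0 [RHS]mulrA -[LHS]mulrA -expRD /k; congr (_ * expR _).
    have -> : Num.sqrt (2 * pi * w) = Num.sqrt w * Num.sqrt (2 * pi) by rewrite -sqrtrM ?ltW// mulrC.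
    by rewrite invfM mulrA divff ?mul1r ?mulr1// gt_eqF// sqrtr_gt0.
  by rewrite /w; field; rewrite gt_eqF.
have k1 : k - 1 <= 4 * c ^+ 2.
  have k0 : 0 < k by rewrite sqrtr_gt0.
  have k2 : k ^+ 2 * (1 - 2 * c ^+ 2) = 1 by rewrite sqr_sqrtr ?ltW// mulVf ?gt_eqF.
  rewrite lerBlDr.
  have k0' := ltW k0.
  have h : 0 <= 4 * c ^+ 2 + 1 by rewrite addr_ge0// mulr_ge0 ?sqr_ge0.
  rewrite -(@ler_pXn2r _ 2) ?nnegrE//.
  rewrite -(ler_pM2r w0') k2.
  by move: (c ^+ 2) (sqr_ge0 c) c2 => z z0 z4; nra.
have j1 a n v : 0 < v -> mu.-integrable setT (EFin \o (fun y => a * gauss_density n v y)).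
  move=> v0; have := integrableZl measurableT a (integrable_gauss_density n v0).
  by apply: eq_integrable => // x _ /=; rewrite EFinM.
have jc a n v : 0 < v -> \int[mu]_y (a * gauss_density n v y) = a.
  move=> v0; rewrite RintegralZl//; last exact: integrable_gauss_density.
  by rewrite /Rintegral integral_gauss_density// mulr1.
apply: le_trans (le_normr_Rintegral measurableT iD) _.
pose a1 := B / 2 * (e - e^-1); pose a2 := B / 2 * k / e.
(* The majorant contains the unbounded [exp (c^2 x^2)], so monotonicity is used for the Lebesgue
   integral instead of [gaussE]; the exponential is absorbed into the density of variance [w]. *)
apply: (@le_trans _ _ (\int[mu]_x (a1 * gauss_density 0 1 x + a2 * gauss_density 0 w x))).
  apply: le_Rintegral => //.
  - by have := integrable_norm iD; apply: eq_integrable.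
  - have := integrableD measurableT (j1 a1 0 1 ltr01) (j1 a2 0 w w0).
    by apply: eq_integrable => // x _ /=; rewrite EFinD.
  - move=> x _; rewrite normrM ger0_norm ?gauss_density_ge0//.
    have h : `|D x| <= B / 2 * (e + (expR ((c * x) ^+ 2) - 1) / e).
      apply: (@gaussE_shift (fun y => f (x, y))) => //; exact: bmeas_pair1.
    apply: le_trans (ler_wpM2l (gauss_density_ge0 _ _ _) h) _.
    have -> : a2 * gauss_density 0 w x = B / 2 / e * (k * gauss_density 0 w x).
      by rewrite /a2; ring.
    rewrite -gdk /a1 le_eqVlt; apply/orP; left; apply/eqP; field.
    by rewrite gt_eqF.
rewrite (RintegralD _ (j1 a1 0 1 ltr01) (j1 a2 0 w w0))// !jc//.
have -> : a1 + a2 = B / 2 * (e + (k - 1) / e).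
  by rewrite /a1 /a2; field; rewrite gt_eqF.
have -> : 2 * B * `|c| = B / 2 * (e + e) by rewrite /e; field.
rewrite ler_wpM2l ?divr_ge0// lerD2l ler_pdivrMr//.
apply: le_trans k1 _; rewrite /e -[c ^+ 2]real_normK ?num_real//.
by rewrite le_eqVlt; apply/orP; left; apply/eqP; ring.
Qed.

End gauss_comparison.

(** * Iterated Gaussian expectations *)

Section iterated_gaussE.
Context {R : realType}.
Implicit Types F G : (nat -> R) -> R.

(* Measurability of a functional of a sequence, tested on all measurable
   families of sequences; this avoids a sigma-algebra on [nat -> R]. *)
Definition smeas F := forall d (T : measurableType d) (X : T -> nat -> R),
  (forall k, measurable_fun setT (fun t => X t k)) ->
  measurable_fun setT (fun t => F (X t)).

(** The first sequence is a parameter, the second is the one that [gexp] integrates out. *)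
Definition smeas2 (K : (nat -> R) -> (nat -> R) -> R) :=
  forall d (T : measurableType d) (X Y : T -> nat -> R),
  (forall k, measurable_fun setT (fun t => X t k)) ->
  (forall k, measurable_fun setT (fun t => Y t k)) ->
  measurable_fun setT (fun t => K (X t) (Y t)).

Definition sbmeas F := smeas F /\ exists B : R, forall x, `|F x| <= B.

Lemma gexpS n F : gexp n.+1 F = gaussE (fun t => gexp n (fun x => F (scons t x))).
Proof. by []. Qed.

Lemma measurable_scons d (T : measurableType d) (u : T -> R) (X : T -> nat -> R) :
  measurable_fun setT u -> (forall k, measurable_fun setT (fun t => X t k)) ->
  forall k, measurable_fun setT (fun t => scons (u t) (X t) k).
Proof. by move=> mu mX [|k] /=. Qed.

Lemma smeas2_gexp n (K : (nat -> R) -> (nat -> R) -> R) (B : R) : smeas2 K ->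
  (forall x y, `|K x y| <= B) ->
  smeas (fun x => gexp n (K x)) /\ forall x, `|gexp n (K x)| <= B.
Proof.
elim: n K => [|n IHn] K mK KB.
  split; last by move=> x; exact: KB.
  by move=> d T X mX; apply: mK => //.
(* The variable of the outermost integral is a parameter for the inner ones: [K'] keeps it in slot 0
   of the first sequence, which makes the induction hypothesis applicable. *)
pose K' x y := K (fun k => x k.+1) (scons (x 0%N) y).
have mK' : smeas2 K'.
  move=> d T X Y mX mY; apply: (mK d T) => [k|k]; first exact: mX.
  exact: (measurable_scons (mX 0%N) mY).
have [m' b'] := IHn K' mK' (fun x y => KB _ _).
have bf d (T : measurableType d) (X : T -> nat -> R) :
    (forall k, measurable_fun setT (fun t => X t k)) ->
    bmeas (fun z : T * R => gexp n (fun y => K (X z.1) (scons z.2 y))).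
  move=> mX; split; last by exists B => z; exact: (b' (scons z.2 (X z.1))).
  apply: (m' _ _ (fun z : T * R => scons z.2 (X z.1))).
  apply: measurable_scons => // k.
  exact: (measurableT_comp (mX k)).
split.
  move=> d T X mX.
  by have [] := bmeas_gaussE (bf _ _ _ mX).
move=> x; rewrite gexpS; apply: normr_gaussE; last first.
  by move=> t; exact: (b' (scons t x)).
have mx k : measurable_fun setT (fun _ : R => x k) by [].
by have [m _] := bf _ R (fun=> x) mx; apply: (measurableT_comp m (pair1_measurable (0 : R))).
Qed.

Lemma sbmeas_scons F t : sbmeas F -> sbmeas (fun x => F (scons t x)).
Proof.
move=> [mF [B FB]]; split; last by exists B.
by move=> d T X mX; apply: mF; exact: measurable_scons.
Qed.

Lemma bmeas_gexp_scons n F : sbmeas F ->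
  bmeas (fun t => gexp n (fun x => F (scons t x))).
Proof.
move=> [mF [B FB]].
pose K (x y : nat -> R) := F (scons (x 0%N) y).
have mK : smeas2 K by move=> d T X Y mX mY; apply: mF; exact: measurable_scons.
have [m b] := smeas2_gexp n mK (fun x y => FB _).
split; last by exists B => t; exact: (b (fun=> t)).
exact: (m _ _ (fun (t : R) (_ : nat) => t)).
Qed.

Lemma gexp_cst n (c : R) : gexp n (fun=> c) = c.
Proof. by elim: n => // n IHn; rewrite gexpS IHn gaussE_cst. Qed.

Lemma le_gexp n F G : sbmeas F -> sbmeas G -> (forall x, F x <= G x) ->
  gexp n F <= gexp n G.
Proof.
elim: n F G => [|n IHn] F G bF bG FG; first exact: FG.
rewrite !gexpS; apply: le_gaussE; try exact: bmeas_gexp_scons.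
by move=> t; apply: IHn => //; exact: sbmeas_scons.
Qed.

Lemma gexpD n F G : sbmeas F -> sbmeas G ->
  gexp n (fun x => F x + G x) = gexp n F + gexp n G.
Proof.
elim: n F G => [//|n IHn] F G bF bG.
rewrite !gexpS -gaussED; try exact: bmeas_gexp_scons.
by congr gaussE; apply/funext => t; apply: IHn => //; exact: sbmeas_scons.
Qed.

Lemma gexpZ n c F : sbmeas F -> gexp n (fun x => c * F x) = c * gexp n F.
Proof.
elim: n F => [//|n IHn] F bF.
rewrite !gexpS -gaussEZ; last exact: bmeas_gexp_scons.
by congr gaussE; apply/funext => t; apply: IHn => //; exact: sbmeas_scons.
Qed.

Lemma sbmeas_cst (c : R) : sbmeas (fun=> c).
Proof. by split; [move=> d T X mX | exists `|c|]. Qed.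

Lemma sbmeasD F G : sbmeas F -> sbmeas G -> sbmeas (fun x => F x + G x).
Proof.
move=> [mF [B FB]] [mG [C GC]]; split.
  by move=> d T X mX; apply: measurable_funD; [exact: mF|exact: mG].
exists (B + C) => x; exact: le_trans (ler_normD _ _) (lerD (FB x) (GC x)).
Qed.

Lemma sbmeasM F G : sbmeas F -> sbmeas G -> sbmeas (fun x => F x * G x).
Proof.
move=> [mF [B FB]] [mG [C GC]]; split.
  by move=> d T X mX; apply: measurable_funM; [exact: mF|exact: mG].
by exists (B * C) => x; rewrite normrM ler_pM.
Qed.

Lemma sbmeas_sum (I : Type) (r : seq I) (P : pred I) (F : I -> (nat -> R) -> R) :
  (forall i, sbmeas (F i)) -> sbmeas (fun x => \sum_(i <- r | P i) F i x).
Proof.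
move=> bF; elim: r => [|i r IHr].
  by under eq_fun do rewrite big_nil; exact: sbmeas_cst.
have [Pi|Pi] := boolP (P i).
  by under eq_fun do rewrite big_cons Pi; exact: sbmeasD.
by under eq_fun do rewrite big_cons (negbTE Pi).
Qed.

Lemma gexp_sum n (I : Type) (r : seq I) (P : pred I) (F : I -> (nat -> R) -> R) :
  (forall i, sbmeas (F i)) ->
  gexp n (fun x => \sum_(i <- r | P i) F i x) = \sum_(i <- r | P i) gexp n (F i).
Proof.
move=> bF; elim: r => [|i r IHr].
  by under eq_fun do rewrite big_nil; rewrite big_nil gexp_cst.
rewrite big_cons; under eq_fun do rewrite big_cons.
case: (P i) => //; rewrite gexpD ?IHr//; exact: sbmeas_sum.
Qed.

Definition scat m (x y : nat -> R) : nat -> R :=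
  fun k => if (k < m)%N then x k else y (k - m)%N.

(** No exchange of integrals is involved: coordinate 0 is the outermost integral of [gexp], so the
    last [n] coordinates already sit inside the first [m]. With [m = N * N] this is conditioning on
    the disorder. *)
Lemma gexp_scat m n F :
  gexp (m + n) F = gexp m (fun x => gexp n (fun y => F (scat m x y))).
Proof.
elim: m F => [|m IHm] F.
  congr gexp; apply/funext => y; congr F; apply/funext => k.
  by rewrite /scat ltn0 subn0.
rewrite addSn !gexpS; congr gaussE; apply/funext => t; rewrite IHm.
congr gexp; apply/funext => x; congr gexp; apply/funext => y; congr F.
by apply/funext => -[|k].
Qed.

(* The rows (al, 0) and (be, de) are the Cholesky factor of the Gram matrix of
   a and b. *)
Lemma gexp_pair n (a b : nat -> R) : exists al be de : R,
  [/\ 0 <= al, 0 <= de,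
      al ^+ 2 = \sum_(i < n) a i ^+ 2,
      al * be = \sum_(i < n) a i * b i &
      be ^+ 2 + de ^+ 2 = \sum_(i < n) b i ^+ 2] /\
  forall f : R * R -> R, bmeas f ->
    gexp n (fun x => f (\sum_(i < n) a i * x i, \sum_(i < n) b i * x i)) =
    gaussE (fun z => gaussE (fun w => f (al * z, be * z + de * w))).
Proof.
elim: n a b => [|n IHn] a b.
  exists 0, 0, 0; split; first by rewrite !big_ord0 !mulr0 expr0n/= addr0; split.
  move=> f bf; rewrite /= !big_ord0.
  under eq_fun do under eq_fun do rewrite !mul0r addr0.
  by under eq_fun do rewrite gaussE_cst; rewrite gaussE_cst.
have [al [be [de [[al0 de0 alE beE deE] H]]]] :=
  IHn (fun i => a i.+1) (fun i => b i.+1).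
pose r := Num.sqrt (a 0%N ^+ 2 + al ^+ 2).
have r2 : r ^+ 2 = a 0%N ^+ 2 + al ^+ 2 by rewrite sqr_sqrtr// addr_ge0 ?sqr_ge0.
have [c [s [cs a0E alE']]] : exists c s, [/\ c ^+ 2 + s ^+ 2 = 1, a 0%N = r * c & al = r * s].
  have [r0|r0] := eqVneq r 0.
    move/eqP: r2; rewrite r0 expr0n/= eq_sym paddr_eq0 ?sqr_ge0// !sqrf_eq0.
    move=> /andP[/eqP -> /eqP ->]; exists 1, 0.
    by rewrite expr1n expr0n/= addr0 !mul0r.
  exists (a 0%N / r), (al / r); split; [|by field|by field].
  by rewrite !expr_div_n -mulrDl -r2 divff// expf_neq0.
(* The rotation sends [(a 0, al)] to [(r, 0)] and [(b 0, be)] to [(be', ga)]. Then [ga] and [de]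
   multiply independent variables that enter only the second sum, so [gaussE_sum] merges them into
   one. *)
pose be' := b 0%N * c + be * s; pose ga := be * c - b 0%N * s.
exists r, be', (Num.sqrt (ga ^+ 2 + de ^+ 2)); split.
  rewrite !big_ord_recl/=; split.
  - exact: sqrtr_ge0.
  - exact: sqrtr_ge0.
  - by rewrite r2 alE.
  - by rewrite -beE a0E alE' /be'; ring.
  - rewrite sqr_sqrtr ?addr_ge0 ?sqr_ge0// -deE addrA.
    rewrite addrA; congr (_ + _).
    transitivity ((c ^+ 2 + s ^+ 2) * (b 0%N ^+ 2 + be ^+ 2)); last by rewrite cs mul1r.
    by rewrite /be' /ga; ring.
move=> f bf; rewrite gexpS.
transitivity (gaussE (fun t => gaussE (fun z => gaussE (fun w =>
    f (a 0%N * t + al * z, b 0%N * t + (be * z + de * w)))))).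
  congr gaussE; apply/funext => t.
  rewrite -(H (fun z => f (a 0%N * t + z.1, b 0%N * t + z.2))); last first.
    apply: (bmeas_comp bf); apply: measurable_fun_pair => //=;
      by apply: measurable_funD.
  by congr gexp; apply/funext => x; rewrite !big_ord_recl.
pose g (z : R * R) := gaussE (fun w => f (r * z.1, be' * z.1 + (ga * z.2 + de * w))).
have bg : bmeas g.
  apply: (bmeas_gaussE (f := fun z : (R * R) * R => f (r * z.1.1, be' * z.1.1 + (ga * z.1.2 + de * z.2)))).
  apply: (bmeas_comp bf); apply: measurable_fun_pair => //=.
    by apply: measurable_funM => //; exact: measurableT_comp.
  apply: measurable_funD.
    by apply: measurable_funM => //; exact: measurableT_comp.
  apply: measurable_funD; apply: measurable_funM => //; exact: measurableT_comp.
transitivity (gaussE (fun x => gaussE (fun y => g (c * x + s * y, - s * x + c * y)))).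
  congr gaussE; apply/funext => t; congr gaussE; apply/funext => z.
  congr gaussE; apply/funext => w /=; congr (f (_, _)).
    by rewrite a0E alE'; ring.
  transitivity ((c ^+ 2 + s ^+ 2) * (b 0%N * t + be * z) + de * w).
    by rewrite cs; ring.
  by rewrite /be' /ga; ring.
rewrite (gaussE_rotation cs bg); congr gaussE; apply/funext => x.
rewrite (@gaussE_sum _ ga de (fun y => f (r * x, be' * x + y)))//.
apply: (bmeas_comp bf); apply: measurable_fun_pair => //=.
exact: measurable_funD.
Qed.

End iterated_gaussE.

(** * Comparison of Gaussian pairs through their Gram matrices *)

Section gram_comparison.
Context {R : realType}.
Implicit Types (f : R * R -> R) (q B : R).

(** For [|q| <= 1] this is the expectation under a standard Gaussian pair with correlation [q]. *)
Definition gaussE2 q f :=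
  gaussE (fun z => gaussE (fun w => f (z, q * z + Num.sqrt (1 - q ^+ 2) * w))).

Let bmeas_lin f (a b c d : R) : bmeas f ->
  bmeas (fun z : R * R => f (a * z.1 + b * z.2, c * z.1 + d * z.2)).
Proof.
move=> bf; apply: (bmeas_comp bf); apply: measurable_fun_pair => //=;
  by apply: measurable_funD => //; apply: measurable_funM.
Qed.

Let bmeas_chol f (al be de : R) : bmeas f ->
  bmeas (fun z : R * R => f (al * z.1, be * z.1 + de * z.2)).
Proof.
move=> bf; have := bmeas_lin al 0 be de bf; congr bmeas.
by apply/funext => z; rewrite mul0r addr0.
Qed.

Let normr_gaussE2 f B (al be de : R) : bmeas f -> (forall z, `|f z| <= B) ->
  `|gaussE (fun z => gaussE (fun w => f (al * z, be * z + de * w)))| <= B.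
Proof.
move=> bf fB; have bc := bmeas_chol al be de bf.
apply: normr_gaussE; first by have [] := bmeas_gaussE bc.
by move=> z; apply: normr_gaussE => //; have [] := bmeas_pair1 z bc.
Qed.

Let chol_close (q al be de eps : R) : `|q| < 1 -> 0 <= al ->
  `|al ^+ 2 - 1| <= eps -> `|be ^+ 2 + de ^+ 2 - 1| <= eps ->
  `|al * be - q| <= eps -> 68 * eps <= 1 ->
  `|be - al * q| <= 4 * eps /\ `|de ^+ 2 - (1 - q ^+ 2)| <= 34 * eps.
Proof.
move=> q1 al0 ha hb hq e68.
have q2 : q ^+ 2 <= 1 by rewrite -[q ^+ 2]real_normK ?num_real// expr_le1// ltW.
have eps0 : 0 <= eps := le_trans (normr_ge0 _) ha.
have al12 : 2^-1 <= al.
  by move: ha; rewrite ler_norml => /andP[h1 h2]; nra.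
set e := be - al * q.
have ale : `|al * e| <= 2 * eps.
  have -> : al * e = (al * be - q) - q * (al ^+ 2 - 1) by rewrite /e; ring.
  apply: le_trans (ler_normB _ _) _; rewrite normrM.
  have : `|q| * `|al ^+ 2 - 1| <= `|al ^+ 2 - 1| by rewrite ler_piMl// ltW.
  lra.
have e4 : `|e| <= 4 * eps.
  have : 2^-1 * `|e| <= `|al * e| by rewrite normrM (ger0_norm al0) ler_wpM2r.
  lra.
split=> //.
have h1 : `|(al ^+ 2 - 1) * q ^+ 2| <= eps.
  rewrite normrM (ger0_norm (sqr_ge0 q)).
  by apply: le_trans ha; rewrite ler_piMr.
have h2 : `|2 * q * (al * e)| <= 4 * eps.
  rewrite -mulrA normrM ger0_norm// normrM.
  have : `|q| * `|al * e| <= `|al * e| by rewrite ler_piMl// ltW.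
  lra.
have h3 : `|e ^+ 2| <= eps.
  rewrite normrX; apply: le_trans (_ : (4 * eps) ^+ 2 <= _).
    by rewrite ler_pXn2r// nnegrE ?mulr_ge0.
  have h : eps * (68 * eps) <= eps * 1 by rewrite ler_wpM2l.
  lra.
have -> : de ^+ 2 - (1 - q ^+ 2) = (be ^+ 2 + de ^+ 2 - 1) -
    ((al ^+ 2 - 1) * q ^+ 2 + 2 * q * (al * e) + e ^+ 2) by rewrite /e; ring.
apply: le_trans (ler_normB _ _) _.
apply: le_trans (lerD hb (le_trans (ler_normD _ _) (lerD (le_trans (ler_normD _ _) (lerD h1 h2)) h3))) _.
lra.
Qed.

Let chol f (al be de : R) :=
  gaussE (fun z => gaussE (fun w => f (al * z, be * z + de * w))).

Let chol_scale2 f B (al be de d : R) : bmeas f -> (forall z, `|f z| <= B) ->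
  0 < de -> 0 < d -> `|(de / d) ^+ 2 - 1| <= 2^-1 ->
  `|chol f al be de - chol f al be d| <= B * `|(de / d) ^+ 2 - 1|.
Proof.
move=> bf fB de0 d0 h.
have b1 := bmeas_gaussE (bmeas_chol al be de bf).
have b2 := bmeas_gaussE (bmeas_chol al be d bf).
rewrite /chol -gaussEB//.
apply: normr_gaussE; first by case: (bmeasB b1 b2).
move=> z /=.
have := @gaussE_scale _ (fun w => f (al * z, be * z + d * w)) (de / d) B
  (bmeas_pair1 z (bmeas_chol al be d bf)) (fun _ => fB _) (divr_gt0 de0 d0) h.
suff -> : (fun w => f (al * z, be * z + d * (de / d * w))) =
    (fun w => f (al * z, be * z + de * w)) by [].
by apply/funext => w; congr (f (_, _)); field; rewrite gt_eqF.
Qed.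

Let chol_shear f B (al be q d : R) : bmeas f -> (forall z, `|f z| <= B) ->
  0 < d -> `|(be - al * q) / d| <= 2^-1 ->
  `|chol f al be d - chol f al (al * q) d| <= 2 * B * `|(be - al * q) / d|.
Proof.
move=> bf fB d0 h.
have := @gaussE_shear _ (fun z => f (al * z.1, al * q * z.1 + d * z.2)) _ B
  (bmeas_chol al (al * q) d bf) (fun _ => fB _) h.
suff -> : (fun x => gaussE (fun y => f (al * (x, y + (be - al * q) / d * x).1,
      al * q * (x, y + (be - al * q) / d * x).1 + d * (x, y + (be - al * q) / d * x).2))) =
    (fun z => gaussE (fun w => f (al * z, be * z + d * w))) by [].
apply/funext => z; congr gaussE; apply/funext => w /=; congr (f (_, _)).
by field; rewrite gt_eqF.
Qed.

Let chol_scale1 f B (al q d : R) : bmeas f -> (forall z, `|f z| <= B) ->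
  0 < al -> `|al ^+ 2 - 1| <= 2^-1 ->
  `|chol f al (al * q) d - chol f 1 q d| <= B * `|al ^+ 2 - 1|.
Proof.
move=> bf fB al0 h.
have bc := bmeas_chol 1 q d bf.
pose v (x : R) := gaussE (fun w => f (1 * x, q * x + d * w)).
have bv : bmeas v by exact: bmeas_gaussE bc.
have vB x : `|v x| <= B by apply: normr_gaussE => //; have [] := bmeas_pair1 x bc.
have := gaussE_scale bv vB al0 h.
suff -> : (fun z => v (al * z)) =
  (fun z => gaussE (fun w => f (al * z, al * q * z + d * w))) by [].
apply/funext => z; congr gaussE; apply/funext => w; rewrite mul1r.
by rewrite [al * q]mulrC -mulrA.
Qed.

(** Three moves reach the limiting factor: rescale the second variable ([de] to
    [d = sqrt (1 - q^2)]), shear ([be] to [al * q]), rescale the first variable ([al] to 1). In this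
    order the last move fixes both rows at once, because [al * q] is proportional to [al]. *)
Let chol_comparison q (al be de eps : R) f B : `|q| < 1 -> bmeas f ->
  (forall z, `|f z| <= B) -> 0 <= al -> 0 <= de ->
  `|al ^+ 2 - 1| <= eps -> `|be ^+ 2 + de ^+ 2 - 1| <= eps ->
  `|al * be - q| <= eps ->
  `|chol f al be de - gaussE2 q f| <= 136 / (1 - q ^+ 2) * B * eps.
Proof.
move=> q1 bf fB al0 de0 ha hb hq.
have B0 : 0 <= B by apply: le_trans (fB (0, 0)).
have eps0 : 0 <= eps := le_trans (normr_ge0 _) ha.
have q2 : q ^+ 2 < 1 by rewrite -[q ^+ 2]real_normK ?num_real// expr_lt1.
have -> : gaussE2 q f = chol f 1 q (Num.sqrt (1 - q ^+ 2)).
  by congr gaussE; apply/funext => z; congr gaussE; apply/funext => w; rewrite mul1r.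
have [dl dlE] : exists dl, dl = 1 - q ^+ 2 by exists (1 - q ^+ 2).
rewrite -dlE.
have dl0 : 0 < dl by rewrite dlE subr_gt0.
have dl1 : dl <= 1 by rewrite dlE; have := sqr_ge0 q; lra.
have dli0 : 0 < dl^-1 by rewrite invr_gt0.
(* If [eps] is not small against [1 - q^2], the trivial bound [2 * B] suffices, and [136 = 2 * 68]
   makes it fit. Otherwise [34 * eps / dl <= 1/2], as the scaling bound requires. *)
have [far|near] := ltP dl (68 * eps).
  have -> : 136 / dl * B * eps = (68 * eps / dl) * (2 * B) by field; rewrite gt_eqF.
  apply: (@le_trans _ _ (1 * (2 * B))); last first.
    by apply: ler_wpM2r; [rewrite mulr_ge0|rewrite ler_pdivlMr// mul1r ltW].
  rewrite mul1r mulr_natl mulr2n; apply: le_trans (ler_normB _ _) _.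
  by apply: lerD; apply: normr_gaussE2.
have e68 : 68 * eps <= 1 by apply: le_trans near dl1.
have [e4] := chol_close q1 al0 ha hb hq e68; rewrite -dlE => de2.
have [d [d0 d2]] : exists d, 0 < d /\ d ^+ 2 = dl.
  by exists (Num.sqrt dl); rewrite sqrtr_gt0 sqr_sqrtr ?ltW.
have -> : Num.sqrt dl = d by rewrite -d2 sqrtr_sqr gtr0_norm.
(* The shear divides by [d], the scaling by [d^2 = dl]; since [d <= 1], both losses can be measured
   by [t = eps / dl]. *)
have ddl : dl <= d.
  have d1 : d <= 1 by rewrite -(@ler_pXn2r _ 2) ?nnegrE ?(ltW d0)// expr1n d2.
  by rewrite -d2 expr2 ler_piMr// ltW.
have di0 : 0 < d^-1 by rewrite invr_gt0.
have al12 : 0 < al.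
  rewrite lt_neqAle al0 andbT eq_sym; apply/eqP => al00.
  by move: ha; rewrite al00 expr0n/= sub0r normrN normr1; lra.
have de0' : 0 < de.
  rewrite lt_neqAle de0 andbT eq_sym; apply/eqP => de00.
  move: de2; rewrite de00 expr0n/= sub0r normrN gtr0_norm//; lra.
have [t tE] : exists t, t = eps / dl by exists (eps / dl).
have t68 : t <= 68^-1 by rewrite tE ler_pdivrMr//; lra.
have et : eps <= t by rewrite tE ler_pdivlMr// ler_piMr.
have dd : `|(de / d) ^+ 2 - 1| <= 34 * t.
  have -> : (de / d) ^+ 2 - 1 = (de ^+ 2 - dl) / dl.
    by rewrite -d2; field; rewrite gt_eqF.
  by rewrite normrM (ger0_norm (ltW dli0)) tE mulrA ler_wpM2r// ltW.
have ed : `|(be - al * q) / d| <= 4 * t.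
  rewrite normrM (ger0_norm (ltW di0)) tE mulrA.
  by apply: ler_pM => //; [exact: ltW|rewrite lef_pV2].
have h34 : 34 * t <= 2^-1 by lra.
have h4 : 4 * t <= 2^-1 by lra.
have h1 : eps <= 2^-1 by lra.
have s1 := @chol_scale2 f B al be de d bf fB de0' d0 (le_trans dd h34).
have s2 := @chol_shear f B al be q d bf fB d0 (le_trans ed h4).
have s3 := @chol_scale1 f B al q d bf fB al12 (le_trans ha h1).
(* The three moves cost 34, 8 and 1 times [B * t]; 93 is the slack up to 136. *)
have -> : 136 / dl * B * eps = B * (34 * t) + (2 * B * (4 * t) + B * t) + 93 * (B * t).
  by rewrite tE; field; rewrite gt_eqF.
have Bt : 0 <= 93 * (B * t) by rewrite !mulr_ge0// (le_trans eps0).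
apply: ler_wpDr => //.
apply: le_trans (ler_distD (chol f al be d) _ _) _; apply: lerD.
  by apply: le_trans s1 _; rewrite ler_wpM2l.
apply: le_trans (ler_distD (chol f al (al * q) d) _ _) _; apply: lerD.
  by apply: le_trans s2 _; rewrite ler_wpM2l// mulr_ge0.
by apply: le_trans s3 _; rewrite ler_wpM2l// (le_trans ha).
Qed.

Lemma gexp_gram_comparison q n (a b : nat -> R) f B : `|q| < 1 -> bmeas f ->
  (forall z, `|f z| <= B) ->
  `|gexp n (fun x => f (\sum_(i < n) a i * x i, \sum_(i < n) b i * x i)) - gaussE2 q f|
  <= 136 / (1 - q ^+ 2) * B *
     (`|\sum_(i < n) a i ^+ 2 - 1| + `|\sum_(i < n) b i ^+ 2 - 1| +
      `|\sum_(i < n) a i * b i - q|).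
Proof.
move=> q1 bf fB; have [al [be [de [[al0 de0 <- <- <-] ->]]]] := gexp_pair n a b => //.
have hx := normr_ge0 (al ^+ 2 - 1).
have hy := normr_ge0 (be ^+ 2 + de ^+ 2 - 1); have hz := normr_ge0 (al * be - q).
by apply: chol_comparison => //; lra.
Qed.

End gram_comparison.

(** * Gaussian mixtures *)

Section sequence_measurability.
Context {R : realType}.
Implicit Types F G : (nat -> R) -> R.

Lemma smeas_cst (c : R) : smeas (fun=> c).
Proof. by move=> d T X mX. Qed.

Lemma smeas_coord k : smeas (fun x : nat -> R => x k).
Proof. by move=> d T X mX; exact: mX. Qed.

Lemma smeasD F G : smeas F -> smeas G -> smeas (fun x => F x + G x).
Proof. by move=> mF mG d T X mX; apply: measurable_funD; [exact: mF|exact: mG]. Qed.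

Lemma smeasM F G : smeas F -> smeas G -> smeas (fun x => F x * G x).
Proof. by move=> mF mG d T X mX; apply: measurable_funM; [exact: mF|exact: mG]. Qed.

Lemma smeas_comp (g : R -> R) F : measurable_fun setT g -> smeas F ->
  smeas (fun x => g (F x)).
Proof. by move=> mg mF d T X mX; apply: (measurableT_comp mg); exact: mF. Qed.

Lemma smeas_sum (I : Type) (r : seq I) (P : pred I) (F : I -> (nat -> R) -> R) :
  (forall i, smeas (F i)) -> smeas (fun x => \sum_(i <- r | P i) F i x).
Proof.
move=> mF; elim: r => [|i r IHr].
  by under eq_fun do rewrite big_nil; exact: smeas_cst.
have [Pi|Pi] := boolP (P i).
  by under eq_fun do rewrite big_cons Pi; refine (smeasD _ IHr); exact: mF.
by under eq_fun do rewrite big_cons (negbTE Pi).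
Qed.

Lemma smeas_inv F : smeas F -> (forall x, 0 < F x) -> smeas (fun x => (F x)^-1).
Proof.
move=> mF F0.
have -> : (fun x => (F x)^-1) = (fun x => expR (-1 * ln (F x))).
  by apply/funext => x; rewrite mulN1r expRN lnK// posrE.
refine (@smeas_comp expR (fun x => -1 * ln (F x)) _ _); first exact: measurable_expR.
refine (smeasM _ _); first exact: smeas_cst.
refine (@smeas_comp (@ln R) F _ mF); exact: measurable_ln.
Qed.

Lemma smeas_gaussE F (v : R) (u : R -> R) : smeas F -> bmeas u ->
  smeas (fun x => gaussE (fun z => u (F x + v * z))).
Proof.
move=> mF bu d T X mX.
have [] // : bmeas (fun t => gaussE (fun z => u (F (X t) + v * z))).
apply: (bmeas_gaussE (f := fun t : T * R => u (F (X t.1) + v * t.2))).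
apply: (bmeas_comp bu); apply: measurable_funD.
  exact: (measurableT_comp (mF _ _ _ mX)).
exact: measurable_funM.
Qed.

End sequence_measurability.

Section mixture.
Context {R : realType}.
Notation mu := (@lebesgue_measure R).

Lemma integral_gauss_densityM (m v : R) (u : R -> R) : 0 < v -> bmeas u ->
  \int[mu]_t (u t * gauss_density m v t) =
  gaussE (fun z => u (m + Num.sqrt v * z)).
Proof.
move=> v0 bu; rewrite gaussE_affine ?sqrtr_gt0// sqr_sqrtr ?ltW//.
by congr Rintegral; apply/funext => t; rewrite mulrC.
Qed.

Let ext n (a : nat -> R) (c0 c1 : R) : nat -> R :=
  fun k => if (k < n)%N then a k else if k == n then c0 else c1.

Let sum_ext n a c0 c1 (x : nat -> R) :
  \sum_(i < n.+2) ext n a c0 c1 i * x i =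
  \sum_(i < n) a i * x i + c0 * x n + c1 * x n.+1.
Proof.
rewrite !big_ord_recr/= /ext ltnn eqxx ltnNge leqnSn/= gtn_eqF//.
by congr (_ + _ + _); apply: eq_bigr => i _; rewrite ltn_ord.
Qed.

Let sum_ext2 n a c0 c1 b d0 d1 :
  \sum_(i < n.+2) ext n a c0 c1 i * ext n b d0 d1 i =
  \sum_(i < n) a i * b i + c0 * d0 + c1 * d1.
Proof.
rewrite sum_ext /ext ltnn eqxx ltnNge leqnSn/= gtn_eqF//.
by congr (_ + _ + _); apply: eq_bigr => i _; rewrite ltn_ord.
Qed.

(** Each factor of the square gets its own auxiliary Gaussian: [V0] and [V1] carry [sv] in different
    slots, so both have squared norm [|m|^2 + 1 - q] while their inner product is [|m|^2]. Since
    [|m|^2] differs from [q] by at most the mean deviation [D], these entries approach 1 and [q]. *)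
Lemma gauss_mixture_comparison n (I : finType) (p : I -> R) (a : I -> nat -> R)
    (u : R -> R) (M q : R) :
  (forall s, 0 <= p s) -> \sum_s p s = 1 ->
  (forall s, \sum_(i < n) a s i ^+ 2 = 1) ->
  measurable_fun setT u -> (forall t, `|u t| <= M) -> 0 <= q -> q < 1 ->
  gexp n (fun y => (\sum_s p s * u (\sum_(i < n) a s i * y i) -
    \int[mu]_t (u t * gauss_density (\sum_s p s * \sum_(i < n) a s i * y i) (1 - q) t)) ^+ 2)
  <= 8 * (136 / (1 - q ^+ 2) * (M * M)) *
     \sum_s \sum_s' p s * p s' * `|\sum_(i < n) a s i * a s' i - q|.
Proof.
move=> p0 p1 a1 mu_ uM q0 q1.
have bu : bmeas u by split=> //; exists M.
have v0 : 0 < 1 - q by rewrite subr_gt0.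
(* V0 and V1 are the mean vector with an independent Gaussian coordinate
   appended, so that gauss_density of variance 1 - q becomes part of gexp. *)
pose sv := Num.sqrt (1 - q).
have sv0 : 0 < sv by rewrite sqrtr_gt0.
have sv2 : sv * sv = 1 - q by rewrite -expr2 sqr_sqrtr// ltW.
pose m i := \sum_s p s * a s i.
pose A s := ext n (a s) 0 0; pose V0 := ext n m sv 0; pose V1 := ext n m 0 sv.
pose L (w x : nat -> R) := \sum_(i < n.+2) w i * x i.
have mE (y : nat -> R) : \sum_s p s * \sum_(i < n) a s i * y i = \sum_(i < n) m i * y i.
  under eq_bigr do rewrite big_distrr/=.
  rewrite exchange_big/=; apply: eq_bigr => i _; rewrite /m big_distrl/=.
  by apply: eq_bigr => s _; rewrite mulrA.
pose H x := \sum_s \sum_s' p s * p s' *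
  ((u (L (A s) x) - u (L V0 x)) * (u (L (A s') x) - u (L V1 x))).
have -> : gexp n (fun y => (\sum_s p s * u (\sum_(i < n) a s i * y i) -
    \int[mu]_t (u t * gauss_density (\sum_s p s * \sum_(i < n) a s i * y i) (1 - q) t)) ^+ 2)
  = gexp n.+2 H.
  transitivity (gexp (n + 2) H); last by rewrite addn2.
  rewrite gexp_scat; congr gexp; apply/funext => y.
  set U := \sum_s p s * u _; rewrite mE; set mm := \sum_(i < n) m i * y i.
  have -> : \int[mu]_t (u t * gauss_density mm (1 - q) t) = gaussE (fun z => u (mm + sv * z)).
    exact: integral_gauss_densityM.
  pose g z := u (mm + sv * z).
  have bg : bmeas g.
    by apply: (bmeas_comp bu); apply: measurable_funD => //; exact: measurable_funM.
  have HE z : H (scat n y z) = (U - g (z 0%N)) * (U - g (z 1%N)).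
    have LA s : L (A s) (scat n y z) = \sum_(i < n) a s i * y i.
      rewrite /L sum_ext !mul0r !addr0; apply: eq_bigr => i _.
      by rewrite /scat ltn_ord.
    have LV c0 c1 : L (ext n m c0 c1) (scat n y z) = mm + c0 * z 0%N + c1 * z 1%N.
      rewrite /L sum_ext /scat ltnn subnn ltnNge leqnSn/= subSnn.
      by congr (_ + _ + _); apply: eq_bigr => i _; rewrite ltn_ord.
    rewrite /H /V0 /V1 !LV !mul0r !addr0 -!/(g _).
    have UE t : U - g t = \sum_s p s * (u (L (A s) (scat n y z)) - g t).
      under eq_bigr do rewrite mulrBr.
      rewrite sumrB -big_distrl/= p1 mul1r; congr (_ - _).
      by apply: eq_bigr => s _; rewrite LA.
    rewrite !UE big_distrl/=; apply: eq_bigr => s _; rewrite big_distrr/=.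
    by apply: eq_bigr => s' _; rewrite mulrACA.
  rewrite (_ : (fun z => H (scat n y z)) = (fun z => (U - g (z 0%N)) * (U - g (z 1%N))));
    last exact/funext/HE.
  have bUg : bmeas (fun t => U - g t) by apply: bmeasB => //; exact: bmeas_cst.
  have EUg : gaussE (fun t => U - g t) = U - gaussE g.
    by rewrite gaussEB ?gaussE_cst//; exact: bmeas_cst.
  transitivity (gaussE (fun s => gaussE (fun t => (U - g s) * (U - g t)))); last by [].
  rewrite (_ : (fun s => gaussE (fun t => (U - g s) * (U - g t))) =
    (fun s => (U - gaussE g) * (U - g s))).
    by rewrite gaussEZ// EUg expr2.
  by apply/funext => s; rewrite gaussEZ// EUg mulrC.
have q2 : `|q| < 1 by rewrite ger0_norm.
pose f (z : R * R) := u z.1 * u z.2.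
have bf : bmeas f.
  apply: bmeasM; [exact: (bmeas_comp bu)|exact: (bmeas_comp bu)].
have fB z : `|f z| <= M * M by rewrite normrM ler_pM.
pose E w w' := gexp n.+2 (fun x => u (L w x) * u (L w' x)).
pose K := 136 / (1 - q ^+ 2) * (M * M).
have M0 : 0 <= M by apply: le_trans (uM 0).
have K0 : 0 <= K.
  have q21 : 0 < 1 - q ^+ 2 by rewrite subr_gt0 expr_lt1.
  by rewrite /K !mulr_ge0// invr_ge0 ltW.
have EK w w' : `|E w w' - gaussE2 q f| <= K * (`|\sum_(i < n.+2) w i ^+ 2 - 1| +
    `|\sum_(i < n.+2) w' i ^+ 2 - 1| + `|\sum_(i < n.+2) w i * w' i - q|).
  exact: (@gexp_gram_comparison _ q n.+2 w w' f (M * M)).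
have sbu w : sbmeas (fun x => u (L w x)).
  split; last by exists M.
  apply: smeas_comp => //; apply: smeas_sum => i.
  by apply: smeasM; [exact: smeas_cst|exact: smeas_coord].
have sbuu w w' : sbmeas (fun x => u (L w x) * u (L w' x)) by exact: sbmeasM.
have HE : gexp n.+2 H = \sum_s \sum_s' p s * p s' *
    (E (A s) (A s') + (-1) * E (A s) V1 + ((-1) * E V0 (A s') + E V0 V1)).
  have sN w w' : sbmeas (fun x => (-1) * (u (L w x) * u (L w' x))).
    by apply: sbmeasM => //; exact: sbmeas_cst.
  have s2 s s' : sbmeas (fun x => u (L (A s) x) * u (L (A s') x) +
      (-1) * (u (L (A s) x) * u (L V1 x)) + ((-1) * (u (L V0 x) * u (L (A s') x)) +
      u (L V0 x) * u (L V1 x))).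
    by apply: sbmeasD; apply: sbmeasD.
  have -> : H = (fun x => \sum_s \sum_s' p s * p s' * (u (L (A s) x) * u (L (A s') x) +
      (-1) * (u (L (A s) x) * u (L V1 x)) + ((-1) * (u (L V0 x) * u (L (A s') x)) +
      u (L V0 x) * u (L V1 x)))).
    apply/funext => x; apply: eq_bigr => s _; apply: eq_bigr => s' _.
    by congr (_ * _); ring.
  have s3 s s' := sbmeasM (sbmeas_cst (p s * p s')) (s2 s s').
  rewrite gexp_sum; last by move=> s; apply: sbmeas_sum => s'; exact: s3.
  apply: eq_bigr => s _; rewrite gexp_sum; last by move=> s'; exact: s3.
  apply: eq_bigr => s' _; rewrite gexpZ//; congr (_ * _).
  by rewrite !gexpD ?gexpZ//; apply: sbmeasD.
rewrite HE -/K.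
pose r s := \sum_s' p s' * `|\sum_(i < n) a s i * a s' i - q|.
pose D := \sum_s p s * r s.
have DE : \sum_s \sum_s' p s * p s' * `|\sum_(i < n) a s i * a s' i - q| = D.
  apply: eq_bigr => s _; rewrite /r big_distrr/=.
  by apply: eq_bigr => s' _; rewrite mulrA.
rewrite DE.
(* Jensen for the weights [p]: replacing a vector by the mean [m] cannot increase the averaged
   deviation from [q]. *)
have Rm s : `|\sum_(i < n) a s i * m i - q| <= r s.
  have -> : \sum_(i < n) a s i * m i - q = \sum_s' p s' * (\sum_(i < n) a s i * a s' i - q).
    under [RHS]eq_bigr do rewrite mulrBr.
    rewrite sumrB -big_distrl/= p1 mul1r; congr (_ - _).
    under [LHS]eq_bigr do rewrite mulrC.
    rewrite -mE; apply: eq_bigr => s' _; congr (_ * _).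
    by apply: eq_bigr => i _; rewrite mulrC.
  apply: le_trans (ler_norm_sum _ _ _) _; apply: ler_sum => s' _.
  by rewrite normrM ger0_norm.
have mR s : `|\sum_(i < n) m i * a s i - q| <= r s.
  by apply: le_trans (Rm s); under eq_bigr do rewrite mulrC.
have Qm : `|\sum_(i < n) m i * m i - q| <= D.
  have -> : \sum_(i < n) m i * m i - q = \sum_s p s * (\sum_(i < n) a s i * m i - q).
    under [RHS]eq_bigr do rewrite mulrBr.
    by rewrite sumrB -big_distrl/= p1 mul1r mE.
  apply: le_trans (ler_norm_sum _ _ _) _; apply: ler_sum => s _.
  by rewrite normrM ger0_norm// ler_wpM2l.
have AA s : \sum_(i < n.+2) A s i ^+ 2 - 1 = 0.
  under eq_bigr do rewrite expr2.
  rewrite sum_ext2 !mul0r !addr0.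
  by under eq_bigr do rewrite -expr2; rewrite a1 subrr.
have VV c0 c1 : c0 * c0 + c1 * c1 = 1 - q ->
    \sum_(i < n.+2) ext n m c0 c1 i ^+ 2 - 1 = \sum_(i < n) m i * m i - q.
  move=> cE; under eq_bigr do rewrite expr2.
  by rewrite sum_ext2; set X := \sum_(i < n) _; rewrite -(addrA X) cE; ring.
have VV0 : \sum_(i < n.+2) V0 i ^+ 2 - 1 = \sum_(i < n) m i * m i - q.
  by apply: VV; rewrite sv2 mul0r addr0.
have VV1 : \sum_(i < n.+2) V1 i ^+ 2 - 1 = \sum_(i < n) m i * m i - q.
  by apply: VV; rewrite sv2 mul0r add0r.
(* The signs are +, -, -, +, so the common value [gaussE2 q f] drops out. The four deviations are
   that of the pair [s, s'], [D + r s], [D + r s'] and [3 * D]; averaging over [s] and [s'] gives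
   [8 * D], the origin of the factor 8. *)
have term s s' : E (A s) (A s') + (-1) * E (A s) V1 + ((-1) * E V0 (A s') + E V0 V1) <=
    K * (`|\sum_(i < n) a s i * a s' i - q| + r s + r s' + 5 * D).
  have h1 := EK (A s) (A s'); rewrite !AA normr0 sum_ext2 !mul0r !addr0 !add0r in h1.
  have h2 := EK (A s) V1; rewrite AA VV1 normr0 sum_ext2 !mul0r !addr0 !add0r in h2.
  have h3 := EK V0 (A s'); rewrite AA VV0 normr0 sum_ext2 !mulr0 !addr0 in h3.
  have h4 := EK V0 V1; rewrite VV0 VV1 sum_ext2 mulr0 mul0r !addr0 in h4.
  have h2' := le_trans h2 (ler_wpM2l K0 (lerD Qm (Rm s))).
  have h3' := le_trans h3 (ler_wpM2l K0 (lerD Qm (mR s'))).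
  have h4' := le_trans h4 (ler_wpM2l K0 (lerD (lerD Qm Qm) Qm)).
  move: h1 h2' h3' h4'.
  move: (E (A s) (A s')) (E (A s) V1) (E V0 (A s')) (E V0 V1) => e1 e2 e3 e4.
  move: `|_ - q| (r s) (r s') (D) (gaussE2 q f) => x y z t G.
  rewrite !ler_norml => /andP[_ k1] /andP[k2 _] /andP[k3 _] /andP[_ k4].
  have -> : e1 + -1 * e2 + (-1 * e3 + e4) = (e1 - G) + - (e2 - G) + (- (e3 - G) + (e4 - G)).
    by ring.
  have -> : K * (x + y + z + 5 * t) = K * x + K * (t + y) + (K * (t + z) + K * (t + t + t)).
    by ring.
  by rewrite !lerD// lerNl.
apply: (@le_trans _ _ (\sum_s \sum_s' p s * p s' *
   (K * (`|\sum_(i < n) a s i * a s' i - q| + r s + r s' + 5 * D)))).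
  apply: ler_sum => s _; apply: ler_sum => s' _.
  by apply: ler_wpM2l => //; rewrite mulr_ge0.
have inner s : \sum_s' p s * p s' *
   (K * (`|\sum_(i < n) a s i * a s' i - q| + r s + r s' + 5 * D)) =
   K * (2 * (p s * r s) + p s * (6 * D)).
  transitivity (K * p s * \sum_s' (p s' * `|\sum_(i < n) a s i * a s' i - q| +
      p s' * r s' + p s' * (r s + 5 * D))).
    by rewrite [RHS]big_distrr/=; apply: eq_bigr => s' _; ring.
  rewrite !big_split/= -big_distrl/= p1 -/(r s) -/D; ring.
under eq_bigr do rewrite inner.
rewrite -big_distrr/= big_split/= -big_distrr/= -big_distrl/= p1 -/D.
by rewrite le_eqVlt; apply/orP; left; apply/eqP; ring.
Qed.

End mixture.

(** * The cavity field of the SK model *)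

Section SK_gibbs.
Context {R : realType}.
Variables (N : nat) (beta h : R).
Local Notation config := {ffun 'I_N -> bool}.
Implicit Types (x y : nat -> R) (s : config).

Definition gibbs_prob x s := gibbs_weight beta h x s / partition_fn N beta h x.

Lemma partition_fn_gt0 x : 0 < partition_fn N beta h x.
Proof.
rewrite /partition_fn (bigD1 [ffun=> true])//=.
by rewrite ltr_pwDl ?expR_gt0// sumr_ge0// => s _; exact: expR_ge0.
Qed.

Lemma gibbs_prob_ge0 x s : 0 <= gibbs_prob x s.
Proof. by rewrite divr_ge0 ?expR_ge0// ltW// partition_fn_gt0. Qed.

Lemma sum_gibbs_prob x : \sum_s gibbs_prob x s = 1.
Proof. by rewrite -big_distrl/= divff// gt_eqF// partition_fn_gt0. Qed.

Lemma gibbs1E x f : gibbs1 N beta h x f = \sum_s gibbs_prob x s * f s.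
Proof.
rewrite /gibbs1 big_distrl/=; apply: eq_bigr => s _.
by rewrite -mulrA mulrC.
Qed.

Lemma gibbs2E x f :
  gibbs2 N beta h x f = \sum_s \sum_s' gibbs_prob x s * gibbs_prob x s' * f s s'.
Proof.
rewrite /gibbs2 big_distrl/=; apply: eq_bigr => s _.
rewrite big_distrl/=; apply: eq_bigr => s' _; rewrite /gibbs_prob.
by field; rewrite gt_eqF// partition_fn_gt0.
Qed.

(** Since [i * N + j < N * N], the Gibbs weights read only the disorder block and stay frozen while
    the cavity block [y] is integrated. *)
Lemma gibbs_prob_scat x y s : gibbs_prob (scat (N * N) x y) s = gibbs_prob x s.
Proof.
have dE (i j : 'I_N) : disorder (scat (N * N) x y) i j = disorder x i j.
  rewrite /disorder /scat; have -> // : (i * N + j < N * N)%N.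
  apply: (@leq_trans (i.+1 * N)); last by rewrite leq_mul2r ltn_ord orbT.
  by rewrite mulSn addnC ltn_add2r.
have wE s' : gibbs_weight beta h (scat (N * N) x y) s' = gibbs_weight beta h x s'.
  rewrite /gibbs_weight /hamiltonian.
  by under eq_bigr do under eq_bigr do rewrite dE.
by rewrite /gibbs_prob /partition_fn wE (eq_bigr _ (fun s' _ => wE s')).
Qed.

(** Indexed by [nat], with 0 outside the range, to match the coordinates of [gexp]. Dividing by
    [sqrt N] turns configurations into vectors whose inner product is the overlap. *)
Definition unit_spin s (k : nat) : R :=
  oapp (spin R s) 0 (insub k) / Num.sqrt N%:R.

Lemma cavity_field_scat x y s :
  cavity_field N (scat (N * N) x y) s = \sum_(i < N) unit_spin s i * y i.
Proof.
rewrite /cavity_field big_distrr/=; apply: eq_bigr => i _.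
rewrite /unit_spin valK/= /cavity /scat ltnNge leq_addr/= addKn.
by rewrite [y i * _]mulrC mulrA [_^-1 * _]mulrC.
Qed.

Lemma overlap_unit_spin s s' :
  overlap N s s' = \sum_(i < N) unit_spin s i * unit_spin s' i :> R.
Proof.
rewrite /overlap big_distrr/=; apply: eq_bigr => i _; rewrite /unit_spin !valK/=.
by rewrite mulrACA -invfM -expr2 sqr_sqrtr// mulrC.
Qed.

Lemma spinM s i : spin R s i * spin R s i = 1.
Proof. by rewrite /spin; case: ifP => _; rewrite ?mulrNN mulr1. Qed.

Lemma overlap_diag s : (0 < N)%N -> overlap N s s = 1 :> R.
Proof.
move=> N0; rewrite /overlap.
under eq_bigr do rewrite spinM.
by rewrite sumr_const card_ord mulVf// pnatr_eq0 -lt0n.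
Qed.

(** Replicas are independent given the disorder, so the mean overlap is [1 / N] times the sum of the
    squared magnetizations. *)
Lemma gibbs_overlap_ge0 x :
  0 <= \sum_s \sum_s' gibbs_prob x s * gibbs_prob x s' * overlap N s s'.
Proof.
have -> : \sum_s \sum_s' gibbs_prob x s * gibbs_prob x s' * overlap N s s' =
    N%:R^-1 * \sum_(i < N) (\sum_s gibbs_prob x s * spin R s i) ^+ 2.
  under [in RHS]eq_bigr do rewrite expr2 big_distrl/=.
  rewrite [in RHS]exchange_big [in RHS]big_distrr/=; apply: eq_bigr => s _.
  under [in RHS]eq_bigr do rewrite big_distrr/=.
  rewrite [in RHS]exchange_big [in RHS]big_distrr/=; apply: eq_bigr => s' _.
  rewrite /overlap mulrCA; congr (_ * _); rewrite big_distrr/=.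
  by apply: eq_bigr => i _; rewrite mulrACA.
by rewrite mulr_ge0// sumr_ge0// => i _; exact: sqr_ge0.
Qed.

Lemma smeas_gibbs_prob s : smeas (fun x => gibbs_prob x s).
Proof.
have mw s' : smeas (fun x => gibbs_weight beta h x s').
  refine (@smeas_comp _ expR (fun x => hamiltonian beta h x s') _ _).
    exact: measurable_expR.
  refine (smeasD _ _); last exact: smeas_cst.
  refine (smeasM _ _); first exact: smeas_cst.
  apply: smeas_sum => i; apply: smeas_sum => j.
  refine (smeasM _ _); last exact: smeas_cst.
  refine (smeasM _ _); last exact: smeas_cst.
  exact: smeas_coord.
refine (smeasM (mw s) _).
refine (smeas_inv _ _); last exact: partition_fn_gt0.
exact: smeas_sum.
Qed.

Lemma sbmeas_gibbs_prob s : sbmeas (fun x => gibbs_prob x s).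
Proof.
split; first exact: smeas_gibbs_prob.
exists 1 => x; rewrite ger0_norm ?gibbs_prob_ge0// -(sum_gibbs_prob x).
by rewrite (bigD1 s)//= lerDl sumr_ge0// => s' _; exact: gibbs_prob_ge0.
Qed.

Lemma sbmeas_gibbs2 (f : config -> config -> R) :
  sbmeas (fun x => \sum_s \sum_s' gibbs_prob x s * gibbs_prob x s' * f s s').
Proof.
apply: sbmeas_sum => s; apply: sbmeas_sum => s'.
apply: sbmeasM; last exact: sbmeas_cst.
by apply: sbmeasM; exact: sbmeas_gibbs_prob.
Qed.

Lemma smeas_cavity_field s : smeas (fun x => cavity_field N x s).
Proof.
refine (smeasM _ _); first exact: smeas_cst.
apply: smeas_sum => i; refine (smeasM _ _); first exact: smeas_coord.
exact: smeas_cst.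
Qed.

Definition cavity_error q (u : R -> R) x :=
  (gibbs1 N beta h x (fun s => u (cavity_field N x s)) -
    \int[@lebesgue_measure R]_t
      (u t * gauss_density (gibbs1 N beta h x (fun s => cavity_field N x s)) (1 - q) t)) ^+ 2.

Lemma sbmeas_cavity_error (u : R -> R) (M q : R) : q < 1 ->
  measurable_fun setT u -> (forall t, `|u t| <= M) ->
  sbmeas (cavity_error q u).
Proof.
move=> q1 mu_ uM; have bu : bmeas u by split=> //; exists M.
have q10 : 0 < 1 - q by rewrite subr_gt0.
pose mm x := \sum_s gibbs_prob x s * cavity_field N x s.
pose F x := \sum_s gibbs_prob x s * u (cavity_field N x s).
pose G x := gaussE (fun z => u (mm x + Num.sqrt (1 - q) * z)).
have mmm : smeas mm.
  apply: smeas_sum => s.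
  exact: smeasM (smeas_gibbs_prob s) (smeas_cavity_field s).
have sF : sbmeas F.
  apply: sbmeas_sum => s; apply: sbmeasM; first exact: sbmeas_gibbs_prob.
  split; last by exists M.
  exact: (@smeas_comp _ u _ mu_ (smeas_cavity_field s)).
have sG : sbmeas G.
  split; first exact: smeas_gaussE.
  exists M => x; apply: normr_gaussE => //.
  by apply: (measurableT_comp mu_); apply: measurable_funD => //; exact: measurable_funM.
have sFG : sbmeas (fun x => F x + (-1) * G x).
  by apply: sbmeasD => //; apply: sbmeasM => //; exact: sbmeas_cst.
have := sbmeasM sFG sFG; congr sbmeas; apply/funext => x.
by rewrite -expr2 /cavity_error !gibbs1E integral_gauss_densityM// mulN1r.
Qed.

(** For frozen disorder the Gibbs measure is a finite family of weights on the unit vectors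
    [unit_spin s], the setting of [gauss_mixture_comparison]. *)
Lemma quenched_cavity x (u : R -> R) (M q : R) : (0 < N)%N ->
  measurable_fun setT u -> (forall t, `|u t| <= M) -> 0 <= q -> q < 1 ->
  gexp N (fun y => cavity_error q u (scat (N * N) x y))
  <= 8 * (136 / (1 - q ^+ 2) * (M * M)) *
     \sum_s \sum_s' gibbs_prob x s * gibbs_prob x s' * `|overlap N s s' - q|.
Proof.
move=> N0 mu_ uM q0 q1.
have a1 s : \sum_(i < N) unit_spin s i ^+ 2 = 1.
  by under eq_bigr do rewrite expr2; rewrite -overlap_unit_spin overlap_diag.
have le := gauss_mixture_comparison (gibbs_prob_ge0 x) (sum_gibbs_prob x) a1 mu_ uM q0 q1.
under eq_bigr do under eq_bigr do rewrite overlap_unit_spin.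
apply: le_trans le; rewrite le_eqVlt; apply/orP; left; apply/eqP.
congr gexp; apply/funext => y; rewrite /cavity_error !gibbs1E.
have e1 (g : R -> R) :
    \sum_s gibbs_prob (scat (N * N) x y) s * g (cavity_field N (scat (N * N) x y) s) =
    \sum_s gibbs_prob x s * g (\sum_(i < N) unit_spin s i * y i).
  by apply: eq_bigr => s _; rewrite gibbs_prob_scat cavity_field_scat.
by rewrite (e1 u) (e1 id).
Qed.

Lemma gexp_gibbs2 (f : config -> config -> R) :
  gexp (ndim N) (fun x => gibbs2 N beta h x f) =
  gexp (N * N) (fun x => \sum_s \sum_s' gibbs_prob x s * gibbs_prob x s' * f s s').
Proof.
rewrite /ndim gexp_scat; congr gexp; apply/funext => x.
rewrite -[RHS](gexp_cst N); congr gexp; apply/funext => y.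
rewrite gibbs2E; apply: eq_bigr => s _; apply: eq_bigr => s' _.
by rewrite !gibbs_prob_scat.
Qed.

Lemma ler_sum_gibbs2 x (f g : config -> config -> R) : (forall s s', f s s' <= g s s') ->
  \sum_s \sum_s' gibbs_prob x s * gibbs_prob x s' * f s s' <=
  \sum_s \sum_s' gibbs_prob x s * gibbs_prob x s' * g s s'.
Proof.
move=> fg; apply: ler_sum => s _; apply: ler_sum => s' _.
by apply: ler_wpM2l => //; rewrite mulr_ge0// gibbs_prob_ge0.
Qed.

Lemma sum_gibbs2_affine x (f : config -> config -> R) (a b : R) :
  \sum_s \sum_s' gibbs_prob x s * gibbs_prob x s' * (a + b * f s s') =
  a + b * \sum_s \sum_s' gibbs_prob x s * gibbs_prob x s' * f s s'.
Proof.
transitivity (\sum_s (gibbs_prob x s * a +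
    b * \sum_s' gibbs_prob x s * gibbs_prob x s' * f s s')).
  apply: eq_bigr => s _.
  transitivity (\sum_s' (gibbs_prob x s * a * gibbs_prob x s' +
     b * (gibbs_prob x s * gibbs_prob x s' * f s s'))).
    by apply: eq_bigr => s' _; ring.
  by rewrite big_split/= -!big_distrr/= sum_gibbs_prob mulr1.
by rewrite big_split/= -big_distrl -big_distrr/= sum_gibbs_prob mul1r.
Qed.

End SK_gibbs.

(** * Sign of [q] and the rate of convergence *)

Theorem theorem1p5 (R : realType) (beta h q C0 : R) :
  0 < beta -> q < 1 ->
  (forall N : nat, (0 < N)%N ->
     gexp (ndim N) (fun x => gibbs2 N beta h x
        (fun s1 s2 => (overlap N s1 s2 - q) ^+ 4)) <= C0 / (N%:R ^+ 2)) ->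
  exists C : R, forall (N : nat) (u : R -> R) (M : R),
    (0 < N)%N -> measurable_fun setT u -> (forall t, `|u t| <= M) ->
    gexp (ndim N) (fun x =>
      (gibbs1 N beta h x (fun s => u (cavity_field N x s))
       - \int[@lebesgue_measure R]_(t in setT)
           (u t * gauss_density (gibbs1 N beta h x (fun s => cavity_field N x s)) (1 - q) t))
      ^+ 2)
    <= C * M ^+ 2 / Num.sqrt (N%:R).
Proof.
move=> beta0 q1 hyp.
have q0 : 0 <= q.
  (* If q < 0, the tangent line of t |-> (t - q)^4 at t = 0 and the
     nonnegativity of the mean overlap bound the fourth moment below by q^4. *)
  rewrite leNgt; apply/negP => qn.
  have q40 : 0 < q ^+ 4 by rewrite exprn_even_gt0//= lt_eqF.
  have low N : (0 < N)%N -> N%:R * q ^+ 4 <= C0.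
    move=> N0; have N0' : 0 < N%:R :> R by rewrite ltr0n.
    have sG : sbmeas (fun x => \sum_s \sum_s' gibbs_prob beta h x s *
        gibbs_prob beta h x s' * (overlap N s s' - q) ^+ 4) by exact: sbmeas_gibbs2.
    have := hyp N N0; rewrite gexp_gibbs2 ler_pdivlMr ?exprn_gt0// => /(le_trans _); apply.
    apply: (@le_trans _ _ (q ^+ 4 * N%:R ^+ 2)).
      have q40' := ltW q40; have N0'' := ltW N0'.
      by rewrite mulrC ler_wpM2l// expr2 ler_peMl// ler1n.
    rewrite ler_wpM2r ?exprn_ge0// -[leLHS](gexp_cst (N * N)).
    apply: le_gexp => //; first exact: sbmeas_cst.
    move=> x.
    apply: (@le_trans _ _ (\sum_(s : {ffun 'I_N -> bool}) \sum_(s' : {ffun 'I_N -> bool})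
        gibbs_prob beta h x s * gibbs_prob beta h x s' *
        (q ^+ 4 + (- 4 * q ^+ 3) * overlap N s s'))).
      rewrite sum_gibbs2_affine lerDl mulr_ge0 ?gibbs_overlap_ge0//.
      by rewrite mulNr oppr_ge0 mulr_ge0_le0// exprS mulr_le0_ge0 ?sqr_ge0// ltW.
    apply: ler_sum_gibbs2 => s s'; move: (overlap N s s') => t.
    rewrite -subr_ge0.
    have -> : (t - q) ^+ 4 - (q ^+ 4 + - 4 * q ^+ 3 * t) =
      t ^+ 2 * ((t - 2 * q) ^+ 2 + 2 * q ^+ 2) by ring.
    by rewrite mulr_ge0 ?sqr_ge0// addr_ge0 ?sqr_ge0// mulr_ge0 ?sqr_ge0.
  (* [low] keeps [N * q^4] below [C0] for every positive [N]; an integer above [C0 / q^4]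
     contradicts it. *)
  have := low (Num.truncn (C0 / q ^+ 4)).+1 isT.
  by rewrite -ler_pdivlMr// leNgt truncnS_gt.
(* The first factor comes from [quenched_cavity]; [1 + C0] comes from
   [1/r + r^3 * (C0 / r^4) = (1 + C0) / r]. *)
exists (8 * 136 / (1 - q ^+ 2) * (1 + C0)) => N u M N0 mu_ uM.
have N0' : 0 < N%:R :> R by rewrite ltr0n.
pose r : R := Num.sqrt N%:R.
have r0 : 0 < r by rewrite sqrtr_gt0.
have r0' := ltW r0.
have r2 : r ^+ 2 = N%:R by rewrite sqr_sqrtr// ltW.
pose c := 8 * (136 / (1 - q ^+ 2) * (M * M)).
have q21 : 0 < 1 - q ^+ 2 by rewrite subr_gt0 expr_lt1.
have M0 : 0 <= M by apply: le_trans (uM 0).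
have c0 : 0 <= c by rewrite /c !mulr_ge0// invr_ge0 ltW.
pose p := gibbs_prob beta h (N := N).
pose G x := \sum_s \sum_s' p x s * p x s' * (overlap N s s' - q) ^+ 4.
have sG : sbmeas G by exact: sbmeas_gibbs2.
rewrite -[gexp _ _]/(gexp (ndim N) (cavity_error N beta h q u)) /ndim gexp_scat.
(* For [t = R_12 - q], either [|t| <= 1/r], or [r |t| >= 1] and hence
   [|t| <= |t| (r |t|)^3 = r^3 t^4]. The threshold [1/r] gives both contributions the same order in
   [N]. *)
apply: (@le_trans _ _ (gexp (N * N) (fun x => c * (r^-1 + r ^+ 3 * G x)))).
  apply: le_gexp.
  - have [mF [B FB]] := sbmeas_cavity_error N beta h q1 mu_ uM.
    have [|m b] := smeas2_gexp N (K := fun x y => cavity_error N beta h q u (scat (N * N) x y)) _ (fun x y => FB _).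
      move=> d T X Y mX mY; apply: (mF _ _ (fun t => scat (N * N) (X t) (Y t))) => k.
      by rewrite /scat; case: (k < N * N)%N.
    by split; [exact: m|exists B; exact: b].
  - apply: sbmeasM; first exact: sbmeas_cst.
    apply: sbmeasD; first exact: sbmeas_cst.
    by apply: sbmeasM => //; exact: sbmeas_cst.
  - move=> x; apply: le_trans (quenched_cavity _ _ _ N0 mu_ uM q0 q1) _.
    apply: ler_wpM2l => //.
    rewrite -sum_gibbs2_affine; apply: ler_sum_gibbs2 => s s'.
    set t := overlap N s s' - q.
    have -> : t ^+ 4 = `|t| ^+ 4.
      by rewrite -normrX ger0_norm// exprn_even_ge0.
    have [tr|tr] := lerP `|t| r^-1.
      by rewrite ler_wpDr// mulr_ge0// exprn_ge0.
    rewrite ler_wpDl ?invr_ge0//.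
    rewrite [_ ^+ 4]exprS mulrCA -exprMn ler_peMr// exprn_ege1//.
    by apply: ltW; rewrite -ltr_pdivrMl// mulr1.
rewrite gexpZ; last first.
  apply: sbmeasD; first exact: sbmeas_cst.
  by apply: sbmeasM => //; exact: sbmeas_cst.
rewrite gexpD ?gexp_cst ?gexpZ//; [|exact: sbmeas_cst|by apply: sbmeasM => //; exact: sbmeas_cst].
have GN : gexp (N * N) G <= C0 / r ^+ 4.
  by rewrite -gexp_gibbs2 (_ : r ^+ 4 = N%:R ^+ 2)//; [exact: hyp|rewrite -r2 -exprM].
apply: (@le_trans _ _ (c * (r^-1 + r ^+ 3 * (C0 / r ^+ 4)))).
  by rewrite ler_wpM2l// lerD2l ler_wpM2l// exprn_ge0.
rewrite le_eqVlt; apply/orP; left; apply/eqP; rewrite /c -/r; field.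
by rewrite !gt_eqF.
Qed.
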